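(* Let $D\subset\mathbb{C}^n$ be a domain containing the origin $O$. Let $\mathcal{S}_1=\{\varphi_t\}_{t\ge 0}$ and $\mathcal{S}_2=\{\psi_t\}_{t\ge 0}$ be two one-parameter continuous semigroups of holomorphic self-mappings of $D$ generated by mappings $f_1$ and $f_2$, respectively, with $f_1(O)=f_2(O)=O$, which commute, i.e. $\varphi_t\circ\psi_s=\psi_s\circ\varphi_t$ for all $t,s\ge 0$. Suppose that $d(f_1)_O=d(f_2)_O=A$, where every eigenvalue of $A$ has negative real part. If $\lambda(A)<2$, then the semigroups coincide, i.e. $\varphi_t=\psi_t$ for all $t\ge 0$.
   Context: A one-parameter continuous semigroup on a domain $D\subset\mathbb{C}^n$ is a family $\{\varphi_t\}_{t\ge 0}$ of holomorphic maps $\varphi_t:D\to D$ with $\varphi_{t+s}=\varphi_t\circ\varphi_s$ for all $s,t\ge 0$ and $\lim_{t\to 0^+}\varphi_t(z)=z$ for all $z\in D$. Its generator is the holomorphic map $f:D\to\mathbb{C}^n$, $f(z)=\lim_{t\to 0^+}\frac{\varphi_t(z)-z}{t}$. For a holomorphic map $g$, $dg_z$ denotes its (complex) Fréchet derivative at $z$. For an $n\times n$ complex matrix $A$ with spectrum $\sigma(A)$ in the open left half-plane, the spectrum distortion index is $$\lambda(A):=\frac{\max_{\alpha\in\sigma(A)}|\mathrm{Re}\,\alpha|}{\min_{\alpha\in\sigma(A)}|\mathrm{Re}\,\alpha|}.$$ *)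

(* Defs.v *)
From HB Require Import structures.
From mathcomp Require Import all_boot all_order all_algebra.
From mathcomp Require Import complex.
From mathcomp Require Import all_classical all_reals all_analysis.

Set Implicit Arguments.
Unset Strict Implicit.
Unset Printing Implicit Defensive.

Import Order.TTheory GRing.Theory Num.Theory.
Import numFieldNormedType.Exports.

Local Open Scope classical_set_scope.
Local Open Scope complex_scope.
Local Open Scope ring_scope.

(* The normed-module structure that every numFieldType carries over itself,
   made canonical on R[i] so that topological notions on R[i]-valued matrices
   are inferred; the scalars are complex, hence [differentiable] and ['d] below
   are complex Frechet differentiability and the complex Frechet derivative. *)
#[export, non_forgetful_inheritance]
HB.instance Definition _ (R : realType) := GRing.ComAlgebra.copy R[i] R[i]^o.
#[export, non_forgetful_inheritance]
HB.instance Definition _ (R : realType) := Vector.copy R[i] R[i]^o.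
#[export, non_forgetful_inheritance]
HB.instance Definition _ (R : realType) := NormedModule.copy R[i] R[i]^o.

Definition complex_domain (R : realType) (n : nat) (D : set 'cV[R[i]]_n) : Prop :=
  [/\ open D, connected D & D !=set0].

Definition holomorphic_on (R : realType) (n : nat) (D : set 'cV[R[i]]_n)
    (g : 'cV[R[i]]_n -> 'cV[R[i]]_n) : Prop :=
  forall z, D z -> differentiable g z.

(* Maps D -> D and D -> C^n are total functions on C^n of which only the values
   on D are used; likewise only times t >= 0 are used. *)
Definition continuous_semigroup (R : realType) (n : nat) (D : set 'cV[R[i]]_n)
    (phi : R -> 'cV[R[i]]_n -> 'cV[R[i]]_n) : Prop :=
  [/\ forall t, 0 <= t -> holomorphic_on D (phi t),
      forall t z, 0 <= t -> D z -> D (phi t z),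
      forall t s z, 0 <= t -> 0 <= s -> D z ->
        phi (t + s) z = phi t (phi s z) &
      forall z, D z -> phi t z @[t --> 0^'+] --> z].

Definition generator (R : realType) (n : nat) (D : set 'cV[R[i]]_n)
    (phi : R -> 'cV[R[i]]_n -> 'cV[R[i]]_n)
    (f : 'cV[R[i]]_n -> 'cV[R[i]]_n) : Prop :=
  holomorphic_on D f /\
  forall z, D z -> (t^-1)%:C *: (phi t z - z) @[t --> 0^'+] --> f z.

Definition semigroups_commute (R : realType) (n : nat) (D : set 'cV[R[i]]_n)
    (phi psi : R -> 'cV[R[i]]_n -> 'cV[R[i]]_n) : Prop :=
  forall t s z, 0 <= t -> 0 <= s -> D z ->
    phi t (psi s z) = psi s (phi t z).

Definition spectrum (R : realType) (n : nat) (A : 'M[R[i]]_n) : set R[i] :=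
  [set a | eigenvalue A a].

(* For n > 0 the spectrum is finite and nonempty, so that [sup] and [inf] are
   the maximum and the minimum. *)
Definition spectrum_distortion (R : realType) (n : nat) (A : 'M[R[i]]_n) : R :=
  sup [set `|complex.Re a| | a in spectrum A] /
  inf [set `|complex.Re a| | a in spectrum A].

(* Main.v *)
Require Import Defs.
From mathcomp Require Import all_boot all_order all_algebra mxred spectral.
From mathcomp Require Import complex.
From mathcomp Require Import all_classical all_reals all_analysis.
From mathcomp Require Import ring lra.

Import Order.TTheory GRing.Theory Num.Theory.
Import numFieldNormedType.Exports.

Local Open Scope classical_set_scope.
Local Open Scope complex_scope.
Local Open Scope ring_scope.

Set Implicit Arguments.
Unset Strict Implicit.
Unset Printing Implicit Defensive.

(** Put g := f2 - f1.  Both generators vanish at 0 and have the same derivative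
    A there, so g vanishes to second order at 0.  Commutation gives
      phi_t (psi_h z) - phi_t (phi_h z) = psi_h (phi_t z) - phi_h (phi_t z),
    and this identity, divided by h as h tends to 0, transports the gap g along
    the flow phi.  Let N be a Euclidean norm, in coordinates adapted to A.  Near
    0 the flow cannot contract differences faster than exp(-b t), where b is any
    number above max |Re alpha|, so N(g(phi_t z)) >= exp(-b t) N(g z).  On the
    other hand orbits tend to 0 at least as fast as exp(-a t), where a is any
    number below min |Re alpha|, and g is quadratic, so
    N(g(phi_t z)) <= C exp(-2 a t).  The condition on the distortion index says
    exactly that a and b can be chosen with b < 2 a; letting t tend to infinity
    gives g z = 0 (generators_agree).  With equal generators near 0, the distance
    N(phi_t z - psi_t z) is non-increasing, hence zero (semigroups_agree), and
    the identity theorem extends phi_t = psi_t from a neighbourhood of 0 to D.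

    Three groups of lemmas carry this.

    Complex analysis, from pointwise differentiability only: Goursat's theorem
    for rectangles by bisection (goursat), deformation of rectangular contours
    (contour_deform), and Cauchy's formula.  They are condensed in
    schwarz_order, a bound 8 M (|z|/s)^n for a function of size at most M that
    vanishes to order n at the centre.  Restricting maps to complex lines, n = 1
    gives strict differentiability of the generators at 0 (strict_derivative),
    n = 2 the quadratic bound on g (quadratic_bound), and all n together the
    identity theorem (identity_theorem).

    Linear algebra: lyapunov_form builds N from a Schur triangularization of A
    whose off-diagonal part is made small by a diagonal scaling.

    Real analysis: the semigroups are only assumed continuous in time at 0 from
    the right.  A right-continuous trajectory has arbitrarily early continuity
    points, and the semigroup law propagates continuity from such a point to all
    later times (semigroup_continuous); a Gronwall lemma for right derivatives
    then turns inequalities on N along the vector field into the two rates. *)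

(** * The norm of a complex normed module as a real number *)

(** The norm of a normed module over R[i] takes values in R[i]; its real part
    carries the same information in a totally ordered field. *)
Definition rnorm (R : realType) (V : normedModType R[i]) (v : V) : R := complex.Re `|v|.
Arguments rnorm {R V} v.

Section RealNorm.
Context {R : realType} {V : normedModType R[i]}.
Implicit Types (v w : V).

Lemma rnormE v : `|v| = (rnorm v)%:C.
Proof. by rewrite /rnorm RRe_real// normr_real. Qed.

Lemma rnorm_ge0 v : 0 <= rnorm v.
Proof. by rewrite -ler0c -rnormE. Qed.

Lemma rnormD v w : rnorm (v + w) <= rnorm v + rnorm w.
Proof. by rewrite -lecR rmorphD /= -!rnormE ler_normD. Qed.

Lemma rnormN v : rnorm (- v) = rnorm v.
Proof. by rewrite /rnorm normrN. Qed.

Lemma rnormB v w : rnorm (v - w) = rnorm (w - v).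
Proof. by rewrite -rnormN opprB. Qed.

Lemma rnormZ (a : R[i]) v : rnorm (a *: v) = rnorm a * rnorm v.
Proof. by apply: complexI; rewrite rmorphM /= -!rnormE normrZ. Qed.

Lemma rnorm0 : rnorm (0 : V) = 0.
Proof. by rewrite /rnorm normr0. Qed.

Lemma rnorm_eq0 v : rnorm v = 0 -> v = 0.
Proof. by move=> v0; apply/normr0_eq0; rewrite rnormE v0. Qed.

Lemma rnorm_gt0 v : v != 0 -> 0 < rnorm v.
Proof.
by move=> v0; rewrite lt_neqAle rnorm_ge0 andbT eq_sym; apply: contra v0 => /eqP/rnorm_eq0 ->.
Qed.

Lemma nbhs_rnormP (p : V) (A : set V) :
  nbhs p A <-> exists2 d : R, 0 < d & forall q, rnorm (q - p) < d -> A q.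
Proof.
split.
  move=> /nbhs_ballP[e /= e0 eA].
  have er : e = (complex.Re e)%:C by rewrite RRe_real// gtr0_real.
  exists (complex.Re e); first by rewrite -ltcR -er.
  move=> q qp; apply: eA; rewrite -ball_normE /= distrC rnormE er.
  by rewrite ltcR.
move=> [d d0 dA]; apply/nbhs_ballP; exists d%:C => /=; first by rewrite ltcR.
move=> q; rewrite -ball_normE /= distrC rnormE ltcR => qp; exact: dA.
Qed.

Lemma cvg_at_right0_rnormP (f : R -> V) (l : V) :
  f t @[t --> 0^'+] --> l <->
  forall e : R, 0 < e -> exists2 d : R, 0 < d & forall t, 0 < t -> t < d -> rnorm (f t - l) < e.
Proof.
split.
  move=> fl e e0.
  have : \forall t \near 0^'+, rnorm (f t - l) < e.
    apply: (fl [set q | rnorm (q - l) < e]); apply/nbhs_rnormP; by exists e.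
  rewrite /at_right /within /= => /nbhs_ballP[d /= d0 dP]; exists d => // t t0 td.
  by apply: dP => //; rewrite /ball /= sub0r normrN gtr0_norm.
move=> H A /nbhs_rnormP[e e0 eA].
have [d d0 dP] := H _ e0.
rewrite /nbhs/= /within /=; apply/nbhs_ballP; exists d => //= t.
rewrite /ball /= sub0r normrN => td t0; apply: eA; apply: dP => //.
by apply: le_lt_trans td; rewrite ler_norm.
Qed.

End RealNorm.

Section RealNormMaps.
Context {R : realType} {V W : normedModType R[i]}.

Lemma differentiable_rnorm (f : V -> W) (p : V) : differentiable f p ->
  forall e : R, 0 < e -> exists2 d : R, 0 < d & forall q, rnorm (q - p) < d ->
    rnorm (f q - f p - 'd f p (q - p)) <= e * rnorm (q - p).
Proof.
move=> /diff_locallyxP[_ fE] e e0.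
have [om omP foE] : exists2 om : V -> W, forall a : R[i], 0 < a -> \forall x \near (0 : V), `|om x| <= a * `|x| &
    forall h, f (h + p) = f p + 'd f p h + om h.
  by eexists; [|exact: fE]; exact: (@littleoP _ _ _ _ (nbhs (0:V)) id).
have eC0 : 0 < e%:C by rewrite ltcR.
have /nbhs_rnormP[d d0 dP] := omP _ eC0.
exists d => // q qd.
have := dP (q - p); rewrite subr0 => /(_ qd).
rewrite !rnormE -rmorphM /= lecR; apply: le_trans.
rewrite le_eqVlt; apply/orP; left.
have := foE (q - p); rewrite subrK => ->.
by rewrite -[in X in X == _]addrA -opprD addrC addKr.
Qed.

End RealNormMaps.

Lemma rnormM {R : realType} (a b : R[i]) : rnorm (a * b) = rnorm a * rnorm b.
Proof. by apply: complexI; rewrite rmorphM /= -!rnormE normrM. Qed.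

Lemma rnormV {R : realType} (a : R[i]) : rnorm a^-1 = (rnorm a)^-1.
Proof. by apply: complexI; rewrite fmorphV /= -!rnormE normfV. Qed.

Lemma rnormX {R : realType} (a : R[i]) n : rnorm (a ^+ n) = rnorm a ^+ n.
Proof. by apply: complexI; rewrite rmorphXn /= -!rnormE normrX. Qed.

Lemma rnormR {R : realType} (a : R) : rnorm (a%:C) = `|a|.
Proof. by rewrite /rnorm normc_def /= expr0n addr0 sqrtr_sqr. Qed.

Lemma rnorm_i {R : realType} : rnorm ('i%C : R[i]) = 1.
Proof. by rewrite /rnorm normc_def /= expr0n expr1n add0r sqrtr1. Qed.

Lemma Re_le_rnorm {R : realType} (a : R[i]) : `|complex.Re a| <= rnorm a.
Proof. by rewrite -lecR -rnormE normc_ge_Re. Qed.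

Lemma Im_le_rnorm {R : realType} (a : R[i]) : `|complex.Im a| <= rnorm a.
Proof.
by rewrite /rnorm normc_def /= -sqrtr_sqr ler_wsqrtr// lerDr sqr_ge0.
Qed.

Lemma rnorm_le_ReIm {R : realType} (a : R[i]) : rnorm a <= `|complex.Re a| + `|complex.Im a|.
Proof.
rewrite /rnorm normc_def /= -[leRHS]ger0_norm ?addr_ge0// -[leRHS]sqrtr_sqr ler_wsqrtr//.
by rewrite sqrrD !real_normK ?num_real// -addrA lerD2l lerDr mulrn_wge0// mulr_ge0.
Qed.

(** * Integrals of complex-valued functions of a real variable *)

Section PathIntegral.
Context {R : realType}.
Implicit Types (F G : R -> R[i]) (a b c m : R).
Notation mu := (@lebesgue_measure R).

Definition path_continuous F a b := forall x, a <= x <= b -> forall e : R, 0 < e ->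
  exists2 d : R, 0 < d & forall y, a <= y <= b -> `|y - x| < d -> rnorm (F y - F x) < e.

Definition path_integral F a b : R[i] :=
  (\int[mu]_(x in `[a, b]) complex.Re (F x)) +i* (\int[mu]_(x in `[a, b]) complex.Im (F x)).

Lemma path_continuous_sub F a b a' b' : a <= a' -> b' <= b ->
  path_continuous F a b -> path_continuous F a' b'.
Proof.
move=> aa bb FC x /andP[ax xb] e e0.
have [|d d0 dP] := FC x _ e e0; first by apply/andP; split; lra.
by exists d => // y /andP[ay yb]; apply: dP; apply/andP; split; lra.
Qed.

Lemma path_continuous_integrable F a b : path_continuous F a b ->
  mu.-integrable `[a, b] (EFin \o (@complex.Re R \o F)) /\
  mu.-integrable `[a, b] (EFin \o (@complex.Im R \o F)).
Proof.
move=> FC; split; apply: continuous_compact_integrable; try exact: segment_compact.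
all: apply/subspace_continuousP => x /=; rewrite in_itv /= => xab; apply/cvgrPdist_lt => e e0.
all: have [d d0 dP] := FC x xab e e0.
all: rewrite /prop_near1 /within /=; apply/nbhs_ballP; exists d => //= y; rewrite /ball /=.
all: rewrite in_itv /= distrC => yx yab; rewrite distrC; apply: le_lt_trans (dP y yab yx).
- by apply: le_trans (Re_le_rnorm _); rewrite raddfB.
- by apply: le_trans (Im_le_rnorm _); rewrite raddfB.
Qed.

Lemma eq_path_integral F G a b : (forall x, a <= x <= b -> F x = G x) ->
  path_integral F a b = path_integral G a b.
Proof.
by move=> FG; congr (_ +i* _); apply: eq_Rintegral => x /=; rewrite inE /= in_itv /= => /FG ->.
Qed.

Lemma path_continuousD F G a b : path_continuous F a b -> path_continuous G a b ->
  path_continuous (fun x => F x + G x) a b.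
Proof.
move=> FC GC x xab e e0; have e2 : 0 < e / 2 by lra.
have [d d0 dP] := FC x xab _ e2; have [d' d'0 d'P] := GC x xab _ e2.
exists (Num.min d d'); first by rewrite lt_min d0.
move=> y yab; rewrite lt_min => /andP[yd yd'].
have -> : F y + G y - (F x + G x) = (F y - F x) + (G y - G x) by ring.
apply: le_lt_trans (rnormD _ _) _; have := dP y yab yd; have := d'P y yab yd'; lra.
Qed.

Lemma path_continuous_cst (z : R[i]) a b : path_continuous (fun=> z) a b.
Proof. by move=> x _ e e0; exists 1 => // y _ _; rewrite subrr rnorm0. Qed.

Lemma path_continuousM F G a b : path_continuous F a b -> path_continuous G a b ->
  path_continuous (fun x => F x * G x) a b.
Proof.
move=> FC GC x xab e e0.
pose K := rnorm (F x) + rnorm (G x) + 1.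
have K0 : 0 < K by rewrite /K; have := rnorm_ge0 (F x); have := rnorm_ge0 (G x); lra.
have e2 : 0 < Num.min 1 (e / (2 * K)) by rewrite lt_min ltr01 /= divr_gt0// mulr_gt0.
have [d d0 dP] := FC x xab _ e2; have [d' d'0 d'P] := GC x xab _ e2.
exists (Num.min d d'); first by rewrite lt_min d0.
move=> y yab; rewrite lt_min => /andP[yd yd'].
have -> : F y * G y - F x * G x = (F y - F x) * (G y - G x) + (F y - F x) * G x + F x * (G y - G x) by ring.
apply: le_lt_trans (rnormD _ _) _; apply: le_lt_trans (lerD (rnormD _ _) (lexx _)) _.
rewrite !rnormM.
have := dP y yab yd; have := d'P y yab yd'; rewrite !lt_min.
set u := rnorm (F y - F x); set v := rnorm (G y - G x).
have u0 : 0 <= u by exact: rnorm_ge0.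
have v0 : 0 <= v by exact: rnorm_ge0.
have f0 : 0 <= rnorm (F x) by exact: rnorm_ge0.
have g0 : 0 <= rnorm (G x) by exact: rnorm_ge0.
move=> /andP[v1 ve] /andP[u1 ue].
rewrite !ltr_pdivlMr ?mulr_gt0// in ve ue.
have uv : u * v <= u by rewrite ler_piMr// ltW.
move: ue ve; rewrite /K; nra.
Qed.

Lemma path_continuousB (f g : R -> R[i]) a b : path_continuous f a b -> path_continuous g a b ->
  path_continuous (fun x => f x - g x) a b.
Proof.
move=> fC gC x xab e e0.
have [d d0 dP] := path_continuousD fC (path_continuousM (@path_continuous_cst (-1) a b) gC) xab e0.
exists d => // y yab yx; have := dP y yab yx.
by rewrite !mulN1r.
Qed.

Lemma path_integralD F G a b : path_continuous F a b -> path_continuous G a b ->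
  path_integral (fun x => F x + G x) a b = path_integral F a b + path_integral G a b.
Proof.
move=> /path_continuous_integrable[F1 F2] /path_continuous_integrable[G1 G2].
rewrite /path_integral; simpc; rewrite -!RintegralD//; congr (_ +i* _).
all: by apply: eq_Rintegral => x _; rewrite raddfD.
Qed.

Lemma path_integralZ (z : R[i]) F a b : path_continuous F a b ->
  path_integral (fun x => z * F x) a b = z * path_integral F a b.
Proof.
move=> /path_continuous_integrable[F1 F2]; case: z => u v.
rewrite /path_integral; simpc.
have Z (k : R) f : mu.-integrable `[a, b] (EFin \o f) ->
  mu.-integrable `[a, b] (EFin \o (fun x => k * f x)).
  by move=> fi; apply: (@integrableZl _ _ _ mu `[a, b]%classic _ k (EFin \o f)).
rewrite -!RintegralZl// -RintegralB; [|by []|exact: Z|exact: Z].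
rewrite -RintegralD; [|by []|exact: Z|exact: Z].
by congr (_ +i* _); apply: eq_Rintegral => x _; case: (F x) => /= *; simpc.
Qed.

Lemma path_integral_cst (z : R[i]) a b : a <= b -> path_integral (fun=> z) a b = (b - a)%:C * z.
Proof.
move=> ab; rewrite /path_integral !Rintegral_cst//= lebesgue_measure_itv /=.
rewrite lte_fin; case: z => u v /=; simpc.
case: ltP => ab' /=; first by rewrite mulrC [v * _]mulrC.
have -> : a = b by lra.
by rewrite subrr !mulr0 !mul0r.
Qed.

Lemma path_integral_cat F a m b : a <= m -> m <= b -> path_continuous F a b ->
  path_integral F a b = path_integral F a m + path_integral F m b.
Proof.
move=> am mb FC; have [F1 F2] := path_continuous_integrable FC.
have [G1 G2] := path_continuous_integrable (path_continuous_sub am (lexx b) FC).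
rewrite /path_integral; simpc.
have H f : mu.-integrable `[a, b] (EFin \o f) -> mu.-integrable `[m, b] (EFin \o f) ->
  \int[mu]_(x in `[a, b]) f x = \int[mu]_(x in `[a, m]) f x + \int[mu]_(x in `[m, b]) f x.
  move=> fi fi'; apply/eqP; rewrite addrC -subr_eq; apply/eqP.
  rewrite Rintegral_itvB ?bnd_simp// Rintegral_itv_obnd_cbnd//.
  by apply: integrableS fi' => // x; exact: subset_itv_oc_cc.
by congr (_ +i* _); exact: H.
Qed.

(** Real and imaginary parts are bounded separately, which costs the factor 2;
    constants are irrelevant to every later estimate. *)
Lemma path_integral_bound F a b (M : R) : a <= b -> path_continuous F a b ->
  (forall x, a <= x <= b -> rnorm (F x) <= M) ->
  rnorm (path_integral F a b) <= 2 * M * (b - a).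
Proof.
move=> ab FC FM; have [F1 F2] := path_continuous_integrable FC.
apply: le_trans (rnorm_le_ReIm _) _ => /=.
have H f : mu.-integrable `[a, b] (EFin \o f) -> (forall x, a <= x <= b -> `|f x| <= M) ->
  `|\int[mu]_(x in `[a, b]) f x| <= M * (b - a).
  move=> fi fM; apply: le_trans (le_normr_Rintegral _ fi) _ => //.
  have -> : M * (b - a) = \int[mu]_(x in `[a, b]) M.
    rewrite Rintegral_cst//= lebesgue_measure_itv /= lte_fin.
    case: ltP => ab' //=; have -> : a = b by lra.
    by rewrite subrr.
  apply: le_Rintegral => //.
  - exact: integrable_norm fi.
  - by have [+ _] := path_continuous_integrable (@path_continuous_cst M%:C a b).
have -> : 2 * M * (b - a) = M * (b - a) + M * (b - a) by ring.
apply: lerD; apply: H => // x xab.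
- by apply: le_trans (FM x xab); exact: Re_le_rnorm.
- by apply: le_trans (FM x xab); exact: Im_le_rnorm.
Qed.

Lemma path_integral_ge F a b (p q : R) : a <= b -> path_continuous F a b ->
  (forall x, a <= x <= b -> p <= complex.Re (F x)) ->
  (forall x, a <= x <= b -> q <= complex.Im (F x)) ->
  p * (b - a) <= complex.Re (path_integral F a b) /\
  q * (b - a) <= complex.Im (path_integral F a b).
Proof.
move=> ab FC Fp Fq; have [F1 F2] := path_continuous_integrable FC.
have [C1 C2] := path_continuous_integrable (@path_continuous_cst (p +i* q) a b).
have := path_integral_cst (p +i* q) ab.
rewrite {1}/path_integral ![_ * (b - a)]mulrC; simpc => -[] <- <-.
split; apply: le_Rintegral => //.
Qed.

End PathIntegral.

(** * Bisection of rectangles *)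

Section Bisection.
Context {R : realType}.

Lemma half_pow_small (w e : R) : 0 < e -> exists n, w / 2 ^+ n < e.
Proof.
move=> e0; have [w0|w0] := leP w 0.
  by exists 0%N; rewrite expr0 divr1 (le_lt_trans w0).
exists (Num.bound (w / e)); rewrite ltr_pdivrMr ?exprn_gt0// -ltr_pdivrMl// mulrC.
have := archi_boundP (ltW (divr_gt0 w0 e0)) => /lt_le_trans; apply.
by rewrite -natrX ler_nat ltnW// ltn_expl.
Qed.

Lemma nested_intervals (u v : nat -> R) : (forall n, u n <= u n.+1) ->
  (forall n, v n.+1 <= v n) -> (forall n, u n <= v n) ->
  exists x, forall n, u n <= x <= v n.
Proof.
move=> uu vv uv.
have uM m n : (m <= n)%N -> u m <= u n by move/(homo_leq (@lexx _ R) (@le_trans _ R) uu).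
have vM m n : (m <= n)%N -> v n <= v m.
  elim: n => [|n IH]; first by rewrite leqn0 => /eqP ->.
  rewrite leq_eqVlt => /predU1P[->//|]; rewrite ltnS => /IH; exact: le_trans.
have uv' m n : u m <= v n.
  apply: le_trans (uM _ _ (leq_maxl m n)) (le_trans (uv _) (vM _ _ (leq_maxr m n))).
exists (sup (range u)) => n; apply/andP; split.
  apply: ub_le_sup; first by exists (v 0%N) => _ [k _ <-].
  by exists n.
apply: ge_sup; first by exists (u 0%N), 0%N.
by move=> _ [k _ <-].
Qed.

(** Goursat's argument in abstract form: if P failed on the whole rectangle it
    would fail on ever smaller quarters, which shrink to a point around which P
    holds on all small rectangles. *)
Lemma rectangle_bisection (P : R -> R -> R -> R -> Prop) (a b c d : R) :
  a <= b -> c <= d ->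
  (forall a' b' c' d', a <= a' -> a' <= b' -> b' <= b -> c <= c' -> c' <= d' -> d' <= d ->
    let p := (a' + b') / 2 in let q := (c' + d') / 2 in
    P a' p c' q -> P p b' c' q -> P a' p q d' -> P p b' q d' -> P a' b' c' d') ->
  (forall x y, a <= x <= b -> c <= y <= d -> exists2 e : R, 0 < e &
    forall a' b' c' d', a <= a' -> a' <= x <= b' -> b' <= b ->
      c <= c' -> c' <= y <= d' -> d' <= d -> b' - a' < e -> d' - c' < e -> P a' b' c' d') ->
  P a b c d.
Proof.
move=> ab cd Psub Ploc; apply: contrapT => nP.
pose ok (r : R * R * R * R) := let: (a', b', c', d') := r in
  [/\ a <= a' <= b' /\ b' <= b, c <= c' <= d' /\ d' <= d & ~ P a' b' c' d'].
pose nest (r s : R * R * R * R) := let: (a1, b1, c1, d1) := r in let: (a2, b2, c2, d2) := s in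
  [/\ a1 <= a2 /\ b2 <= b1, c1 <= c2 /\ d2 <= d1, b2 - a2 = (b1 - a1) / 2 & d2 - c2 = (d1 - c1) / 2].
have /choice[f fP] : forall r, exists s, ok r -> ok s /\ nest r s.
  move=> r; have [okr|] := pselect (ok r); last by exists r.
  case: r okr => [[[a' b'] c'] d'] [] [/andP[h1 h2] h3] [/andP[h4 h5] h6] nP'.
  set p := (a' + b') / 2; set q := (c' + d') / 2.
  have ap : a' <= p by rewrite /p; lra.
  have pb : p <= b' by rewrite /p; lra.
  have cq : c' <= q by rewrite /q; lra.
  have qd : q <= d' by rewrite /q; lra.
  have e1 : p - a' = (b' - a') / 2 by rewrite /p; lra.
  have e2 : b' - p = (b' - a') / 2 by rewrite /p; lra.
  have e3 : q - c' = (d' - c') / 2 by rewrite /q; lra.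
  have e4 : d' - q = (d' - c') / 2 by rewrite /q; lra.
  have [P1|] := pselect (P a' p c' q); last first.
    by exists (a', p, c', q) => _; split=> //; split=> //; split; try lra; apply/andP; split; lra.
  have [P2|] := pselect (P p b' c' q); last first.
    by exists (p, b', c', q) => _; split=> //; split=> //; split; try lra; apply/andP; split; lra.
  have [P3|] := pselect (P a' p q d'); last first.
    by exists (a', p, q, d') => _; split=> //; split=> //; split; try lra; apply/andP; split; lra.
  have [P4|] := pselect (P p b' q d'); last first.
    by exists (p, b', q, d') => _; split=> //; split=> //; split; try lra; apply/andP; split; lra.
  by exfalso; apply: nP'; apply: Psub.
pose r n := iter n f (a, b, c, d).
have okr n : ok (r n).
  elim: n => [|n IH]; last by have [] := fP _ IH.
  by split=> //; split=> //; apply/andP; split.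
have nestr n : nest (r n) (r n.+1) by have [] := fP _ (okr n).
pose A n := (r n).1.1.1; pose B n := (r n).1.1.2; pose C n := (r n).1.2; pose D n := (r n).2.
have okr' n : [/\ a <= A n <= B n /\ B n <= b, c <= C n <= D n /\ D n <= d & ~ P (A n) (B n) (C n) (D n)].
  by have := okr n; rewrite /A /B /C /D; case: (r n) => [[[? ?] ?] ?].
have nestr' n : [/\ A n <= A n.+1 /\ B n.+1 <= B n, C n <= C n.+1 /\ D n.+1 <= D n,
    B n.+1 - A n.+1 = (B n - A n) / 2 & D n.+1 - C n.+1 = (D n - C n) / 2].
  by have := nestr n; rewrite /A /B /C /D; case: (r n) (r n.+1) => [[[? ?] ?] ?] [[[? ?] ?] ?].
have [x xP] : exists x, forall n, A n <= x <= B n.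
  by apply: nested_intervals => n; [case: (nestr' n) => -[]..|case: (okr' n) => -[/andP[]]].
have [y yP] : exists y, forall n, C n <= y <= D n.
  by apply: nested_intervals => n; [case: (nestr' n) => _ []..|case: (okr' n) => _ [/andP[]]].
have wB n : B n - A n = (b - a) / 2 ^+ n.
  elim: n => [|n IH]; first by rewrite expr0 divr1.
  by case: (nestr' n) => _ _ -> _; rewrite IH exprS invfM mulrCA mulrC.
have wD n : D n - C n = (d - c) / 2 ^+ n.
  elim: n => [|n IH]; first by rewrite expr0 divr1.
  by case: (nestr' n) => _ _ _ ->; rewrite IH exprS invfM mulrCA mulrC.
have [e e0 eP] := Ploc x y (xP 0%N) (yP 0%N).
have [n nP'] := half_pow_small ((b - a) + (d - c)) e0.
have [[/andP[h1 h2] h3] [/andP[h4 h5] h6] h7] := okr' n.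
have n0 : 0 < 2 ^+ n :> R by rewrite exprn_gt0.
have p1 : 0 <= (b - a) / 2 ^+ n by rewrite -wB; lra.
have p2 : 0 <= (d - c) / 2 ^+ n by rewrite -wD; lra.
by apply: h7; apply: eP => //; rewrite ?wB ?wD; move: nP'; rewrite mulrDl; lra.
Qed.

Lemma le0_of_eps (x K : R) : (forall e, 0 < e -> x <= e * K) -> x <= 0.
Proof.
move=> H; rewrite leNgt; apply/negP => x0.
have K0 : 0 < K.
  by have := H 1 ltr01; rewrite mul1r; apply: lt_le_trans.
have := H (x / (2 * K)); rewrite divr_gt0 ?mulr_gt0// => /(_ isT).
have -> : x / (2 * K) * K = x / 2 by field; lra.
lra.
Qed.

End Bisection.

(** * Complex differentiability in one variable *)

Section ComplexDerivative.
Context {R : realType}.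
Implicit Types (F G : R[i] -> R[i]) (z w : R[i]).

Definition cont_at F z := forall e : R, 0 < e ->
  exists2 d : R, 0 < d & forall w, rnorm (w - z) < d -> rnorm (F w - F z) < e.

Definition cderivable F z := exists l, forall e : R, 0 < e ->
  exists2 d : R, 0 < d & forall w, rnorm (w - z) < d ->
    rnorm (F w - F z - l * (w - z)) <= e * rnorm (w - z).

Lemma cderivable_lip F z : cderivable F z ->
  exists2 K : R, 0 < K & exists2 d : R, 0 < d & forall w, rnorm (w - z) < d ->
    rnorm (F w - F z) <= K * rnorm (w - z).
Proof.
move=> [l /(_ 1 ltr01)[d d0 dP]]; exists (1 + rnorm l).
  by have := rnorm_ge0 l; lra.
exists d => // w /dP h.
have -> : F w - F z = (F w - F z - l * (w - z)) + l * (w - z) by ring.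
by apply: le_trans (rnormD _ _) _; rewrite rnormM mulrDl lerD.
Qed.

Lemma cderivable_cont F z : cderivable F z -> cont_at F z.
Proof.
move=> /cderivable_lip[K K0 [d d0 dP]] e e0.
exists (Num.min d (e / K)); first by rewrite lt_min d0 divr_gt0.
move=> w; rewrite lt_min ltr_pdivlMr// => /andP[/dP h wK].
by apply: le_lt_trans h _; rewrite mulrC.
Qed.

Lemma cderivable_cst (a : R[i]) z : cderivable (fun=> a) z.
Proof.
exists 0 => e e0; exists 1 => // w _.
by rewrite subrr mul0r subr0 rnorm0 mulr_ge0 ?rnorm_ge0// ltW.
Qed.

Lemma cderivableB F G z : cderivable F z -> cderivable G z -> cderivable (fun w => F w - G w) z.
Proof.
move=> [l lP] [m mP]; exists (l - m) => e e0.
have e2 : 0 < e / 2 by lra.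
have [d d0 dP] := lP _ e2; have [d' d'0 d'P] := mP _ e2.
exists (Num.min d d'); first by rewrite lt_min d0.
move=> w; rewrite lt_min => /andP[/dP h /d'P h'].
have -> : F w - G w - (F z - G z) - (l - m) * (w - z) =
  (F w - F z - l * (w - z)) + - (G w - G z - m * (w - z)) by ring.
apply: le_trans (rnormD _ _) _; rewrite rnormN; lra.
Qed.

Lemma cderivableM F G z : cderivable F z -> cderivable G z -> cderivable (fun w => F w * G w) z.
Proof.
move=> DF DG; have [K K0 [d1 d10 d1P]] := cderivable_lip DF.
have [L L0 [d2 d20 d2P]] := cderivable_lip DG.
case: DF DG => l lP [m mP]; exists (l * G z + F z * m) => e e0.
set g := rnorm (G z); set f := rnorm (F z).
have g0 : 0 <= g by exact: rnorm_ge0.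
have f0 : 0 <= f by exact: rnorm_ge0.
have S0 : 0 < 3 * (g + f + 1) by lra.
have e3 : 0 < e / (3 * (g + f + 1)) by rewrite divr_gt0.
have [d d0 dP] := lP _ e3; have [d' d'0 d'P] := mP _ e3.
exists (Num.min (Num.min d d') (Num.min (Num.min d1 d2) (e / (3 * K * L)))).
  by rewrite !lt_min d0 d'0 d10 d20 divr_gt0// !mulr_gt0.
move=> w; rewrite !lt_min => /andP[/andP[/dP h /d'P h'] /andP[/andP[/d1P h1 /d2P h2]]].
rewrite ltr_pdivlMr ?mulr_gt0// => h3.
have -> : F w * G w - F z * G z - (l * G z + F z * m) * (w - z) =
  (F w - F z - l * (w - z)) * G z + F z * (G w - G z - m * (w - z)) + (F w - F z) * (G w - G z) by ring.
apply: le_trans (rnormD _ _) _; apply: le_trans (lerD (rnormD _ _) (lexx _)) _.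
rewrite !rnormM -/g -/f.
have x0 := rnorm_ge0 (w - z); move: x0 h h' h1 h2 h3.
set x := rnorm (w - z) => x0 h h' h1 h2 h3.
have A1 : e / (3 * (g + f + 1)) * x * g + f * (e / (3 * (g + f + 1)) * x) <= 2 / 3 * (e * x).
  have -> : e / (3 * (g + f + 1)) * x * g + f * (e / (3 * (g + f + 1)) * x) =
    (g + f) / (g + f + 1) * (e * x) / 3 by field; lra.
  have : (g + f) / (g + f + 1) <= 1 by rewrite ler_pdivrMr; lra.
  have : 0 <= e * x by rewrite mulr_ge0// ltW.
  nra.
have A2 : K * x * (L * x) <= e * x / 3.
  have -> : K * x * (L * x) = (x * (3 * K * L)) * x / 3 by field.
  by rewrite ler_pM2r ?invr_gt0// ler_wpM2r// ltW.
have B1 : rnorm (F w - F z - l * (w - z)) * g <= e / (3 * (g + f + 1)) * x * g by rewrite ler_wpM2r.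
have B2 : f * rnorm (G w - G z - m * (w - z)) <= f * (e / (3 * (g + f + 1)) * x) by rewrite ler_wpM2l.
have B3 : rnorm (F w - F z) * rnorm (G w - G z) <= K * x * (L * x) by rewrite ler_pM// rnorm_ge0.
lra.
Qed.

Lemma cderivable_inv (p z : R[i]) : z != p -> cderivable (fun w => (w - p)^-1) z.
Proof.
move=> zp; have zp0 : z - p != 0 by rewrite subr_eq0.
exists (- (z - p)^-2) => e e0.
have n0 : 0 < rnorm (z - p) by rewrite rnorm_gt0.
set n := rnorm (z - p) in n0 *.
exists (Num.min (n / 2) (e * n ^+ 3 / 2)).
  by rewrite lt_min !divr_gt0// mulr_gt0// exprn_gt0.
move=> w; rewrite lt_min => /andP[h1 h2].
have wn : n / 2 <= rnorm (w - p).
  have := rnormD (w - p) (- (w - z)).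
  have -> : w - p - (w - z) = z - p by ring.
  rewrite rnormN -/n; lra.
have wp : w - p != 0.
  by apply/eqP => w0; move: wn; rewrite w0 rnorm0; lra.
have -> : (w - p)^-1 - (z - p)^-1 - - (z - p)^-2 * (w - z) = (w - z) ^+ 2 / ((w - p) * (z - p) ^+ 2).
  by field; rewrite wp zp0.
rewrite rnormM rnormV rnormM !rnormX -/n expr2 -mulrA [e * _]mulrC ler_wpM2l ?rnorm_ge0//.
have D0 : 0 < n / 2 * n ^+ 2 by rewrite mulr_gt0 ?divr_gt0// exprn_gt0.
have D1 : n / 2 * n ^+ 2 <= rnorm (w - p) * n ^+ 2 by rewrite ler_wpM2r// exprn_ge0// ltW.
rewrite ler_pdivrMr; last exact: lt_le_trans D1.
apply: le_trans (ltW h2) _.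
have -> : e * n ^+ 3 / 2 = e * (n / 2 * n ^+ 2) by field.
by rewrite ler_pM2l.
Qed.

End ComplexDerivative.

(** * Contour integrals over rectangles and Goursat's theorem *)

Section Contour.
Context {R : realType}.
Implicit Types (F G : R[i] -> R[i]) (z w : R[i]) (a b c d : R).

(** Opposite sides are paired under a single integral sign, so that the contour
    integral of an affine function has constant integrands. *)
Definition contour F a b c d : R[i] :=
  path_integral (fun x => F (x +i* c) - F (x +i* d)) a b +
  'i%C * path_integral (fun y => F (b +i* y) - F (a +i* y)) c d.

Lemma horizontal_cont F y a b : (forall x, a <= x <= b -> cont_at F (x +i* y)) ->
  path_continuous (fun x => F (x +i* y)) a b.
Proof.
move=> H x xab e e0; have [d d0 dP] := H x xab e e0.
exists d => // x' _ xx; apply: dP.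
have -> : (x' +i* y) - (x +i* y) = (x' - x)%:C by simpc.
by rewrite rnormR.
Qed.

Lemma vertical_cont F x c d : (forall y, c <= y <= d -> cont_at F (x +i* y)) ->
  path_continuous (fun y => F (x +i* y)) c d.
Proof.
move=> H y ycd e e0; have [t t0 tP] := H y ycd e e0.
exists t => // y' _ yy; apply: tP.
have -> : (x +i* y') - (x +i* y) = 'i%C * (y' - y)%:C by simpc.
by rewrite rnormM rnormR rnorm_i mul1r.
Qed.

Lemma contour_cat_x F a m b c d : a <= m -> m <= b -> c <= d ->
  (forall x, a <= x <= b -> cont_at F (x +i* c)) ->
  (forall x, a <= x <= b -> cont_at F (x +i* d)) ->
  (forall y, c <= y <= d -> cont_at F (a +i* y)) ->
  (forall y, c <= y <= d -> cont_at F (m +i* y)) ->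
  (forall y, c <= y <= d -> cont_at F (b +i* y)) ->
  contour F a b c d = contour F a m c d + contour F m b c d.
Proof.
move=> am mb cd Cc Cd Ca Cm Cb; rewrite /contour (path_integral_cat am mb); last first.
  by apply: path_continuousB; exact: horizontal_cont.
have -> : path_integral (fun y => F (b +i* y) - F (a +i* y)) c d =
  path_integral (fun y => F (m +i* y) - F (a +i* y)) c d +
  path_integral (fun y => F (b +i* y) - F (m +i* y)) c d.
  rewrite -path_integralD; last 2 first.
  - by apply: path_continuousB; exact: vertical_cont.
  - by apply: path_continuousB; exact: vertical_cont.
  by apply: eq_path_integral => y _; ring.
by ring.
Qed.

Lemma contour_cat_y F a b c m d : a <= b -> c <= m -> m <= d ->
  (forall x, a <= x <= b -> cont_at F (x +i* c)) ->
  (forall x, a <= x <= b -> cont_at F (x +i* m)) ->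
  (forall x, a <= x <= b -> cont_at F (x +i* d)) ->
  (forall y, c <= y <= d -> cont_at F (a +i* y)) ->
  (forall y, c <= y <= d -> cont_at F (b +i* y)) ->
  contour F a b c d = contour F a b c m + contour F a b m d.
Proof.
move=> ab cm md Cc Cm Cd Ca Cb; rewrite /contour (path_integral_cat cm md); last first.
  by apply: path_continuousB; exact: vertical_cont.
have -> : path_integral (fun x => F (x +i* c) - F (x +i* d)) a b =
  path_integral (fun x => F (x +i* c) - F (x +i* m)) a b +
  path_integral (fun x => F (x +i* m) - F (x +i* d)) a b.
  rewrite -path_integralD; last 2 first.
  - by apply: path_continuousB; exact: horizontal_cont.
  - by apply: path_continuousB; exact: horizontal_cont.
  by apply: eq_path_integral => y _; ring.
by ring.
Qed.

Lemma rnorm_pt_sub x y x' y' : rnorm ((x' +i* y') - (x +i* y) : R[i]) <= `|x' - x| + `|y' - y|.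
Proof. by apply: le_trans (rnorm_le_ReIm _) _; simpc => /=. Qed.

Definition frame a b c d x y :=
  (a <= x <= b /\ (y = c \/ y = d)) \/ ((x = a \/ x = b) /\ c <= y <= d).

Lemma contour_path_cont F a b c d :
  (forall x y, frame a b c d x y -> cont_at F (x +i* y)) ->
  path_continuous (fun x => F (x +i* c) - F (x +i* d)) a b /\
  path_continuous (fun y => F (b +i* y) - F (a +i* y)) c d.
Proof.
move=> CF; split.
  by apply: path_continuousB; apply: horizontal_cont => x xab; apply: CF; left; split; auto.
by apply: path_continuousB; apply: vertical_cont => y ycd; apply: CF; right; split; auto.
Qed.

Lemma contour_bound F a b c d (M : R) : a <= b -> c <= d ->
  (forall x y, frame a b c d x y -> cont_at F (x +i* y)) ->
  (forall x y, frame a b c d x y -> rnorm (F (x +i* y)) <= M) ->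
  rnorm (contour F a b c d) <= 4 * M * ((b - a) + (d - c)).
Proof.
move=> ab cd /contour_path_cont[C1 C2] FM.
apply: le_trans (rnormD _ _) _; rewrite rnormM rnorm_i mul1r.
have -> : 4 * M * ((b - a) + (d - c)) = 2 * (M + M) * (b - a) + 2 * (M + M) * (d - c) by ring.
apply: lerD; apply: path_integral_bound => // x xab; apply: le_trans (rnormD _ _) _.
  by rewrite rnormN lerD//; apply: FM; left; split; auto.
by rewrite rnormN lerD//; apply: FM; right; split; auto.
Qed.

Lemma eq_contour F G a b c d : (forall x y, frame a b c d x y -> F (x +i* y) = G (x +i* y)) ->
  contour F a b c d = contour G a b c d.
Proof.
move=> FG; rewrite /contour; apply: (f_equal2 +%R); last refine (f_equal (GRing.mul _) _).
all: apply: eq_path_integral => x xab.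
  by rewrite !FG//; left; split; auto.
by rewrite !FG//; right; split; auto.
Qed.

Lemma contourD F G a b c d :
  (forall x y, frame a b c d x y -> cont_at F (x +i* y)) ->
  (forall x y, frame a b c d x y -> cont_at G (x +i* y)) ->
  contour (fun z => F z + G z) a b c d = contour F a b c d + contour G a b c d.
Proof.
move=> /contour_path_cont[F1 F2] /contour_path_cont[G1 G2].
rewrite /contour [RHS]addrACA -mulrDr -!path_integralD//.
by apply: (f_equal2 +%R); last refine (f_equal (GRing.mul _) _); apply: eq_path_integral => u _; ring.
Qed.

Lemma contourZ (k : R[i]) F a b c d :
  (forall x y, frame a b c d x y -> cont_at F (x +i* y)) ->
  contour (fun z => k * F z) a b c d = k * contour F a b c d.
Proof.
move=> /contour_path_cont[F1 F2].
rewrite /contour mulrDr mulrCA -(path_integralZ k F1) -(path_integralZ k F2).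
by apply: (f_equal2 +%R); last refine (f_equal (GRing.mul _) _); apply: eq_path_integral => u _; ring.
Qed.

Lemma contour_affine (k l : R[i]) a b c d : a <= b -> c <= d ->
  contour (fun z => k + l * z) a b c d = 0.
Proof.
move=> ab cd; rewrite /contour.
rewrite (eq_path_integral (G := fun=> - l * ('i%C * (d - c)%:C))); last first.
  move=> u _.
  have -> : 'i%C * (d - c)%:C = (u +i* d) - (u +i* c) by simpc.
  by ring.
rewrite (eq_path_integral (F := fun x => k + l * (b +i* x) - _)
    (G := fun=> l * (b - a)%:C)); last first.
  move=> u _.
  have -> : (b - a)%:C = (b +i* u) - (a +i* u) by simpc.
  by ring.
by rewrite !path_integral_cst//; ring.
Qed.

Lemma cont_at_affine (k l z : R[i]) : cont_at (fun z => k + l * z) z.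
Proof.
move=> e e0; exists (e / (1 + rnorm l)).
  by rewrite divr_gt0//; have := rnorm_ge0 l; lra.
move=> w; rewrite ltr_pdivlMr; last by have := rnorm_ge0 l; lra.
apply: le_lt_trans.
have -> : k + l * w - (k + l * z) = l * (w - z) by ring.
by rewrite rnormM mulrC ler_wpM2l ?rnorm_ge0// lerDr.
Qed.

Lemma contour_quarters F a p b c q d : a <= p -> p <= b -> c <= q -> q <= d ->
  (forall x y, a <= x <= b -> c <= y <= d -> cont_at F (x +i* y)) ->
  contour F a b c d = (contour F a p c q + contour F p b c q) +
    (contour F a p q d + contour F p b q d).
Proof.
move=> ap pb cq qd CF.
have ab := le_trans ap pb; have cd := le_trans cq qd.
rewrite (@contour_cat_y F a b c q d)// ?(@contour_cat_x F a p b)//.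
all: have sx x u v : a <= u -> v <= b -> u <= x <= v -> a <= x <= b
  by move=> au vb /andP[ux xv]; rewrite (le_trans au) ?(le_trans xv).
all: have sy y u v : c <= u -> v <= d -> u <= y <= v -> c <= y <= d
  by move=> au vb /andP[ux xv]; rewrite (le_trans au) ?(le_trans xv).
all: move=> t tP; apply: CF; rewrite ?lexx ?ap ?pb ?cq ?qd ?ab ?cd//.
all: by [apply: sx tP|apply: sy tP].
Qed.

Lemma dist_in_rectangle a b c d x y x' y' : a <= x <= b -> c <= y <= d ->
  a <= x' <= b -> c <= y' <= d ->
  rnorm ((x' +i* y') - (x +i* y) : R[i]) <= (b - a) + (d - c).
Proof.
move=> /andP[? ?] /andP[? ?] /andP[? ?] /andP[? ?].
by apply: le_trans (rnorm_pt_sub _ _ _ _) _; rewrite lerD// ler_norml; apply/andP; split; lra.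
Qed.

Lemma frame_rect a b c d x y : a <= b -> c <= d -> frame a b c d x y ->
  a <= x <= b /\ c <= y <= d.
Proof.
by move=> ab cd [[xab []->]|[[]-> ycd]]; split=> //; apply/andP; split.
Qed.

(** The bound |contour| <= e (width^2 + height^2) passes from the four quarters to
    the whole for every e, and holds on small rectangles around any point, because
    there F is affine up to an error e' |z - z0| and affine functions integrate to
    zero. *)
Theorem goursat F a b c d : a <= b -> c <= d ->
  (forall x y, a <= x <= b -> c <= y <= d -> cderivable F (x +i* y)) ->
  contour F a b c d = 0.
Proof.
move=> ab cd DF; apply: rnorm_eq0; apply/eqP; rewrite eq_le rnorm_ge0 andbT.
have CF x y : a <= x <= b -> c <= y <= d -> cont_at F (x +i* y).
  by move=> ? ?; apply: cderivable_cont; exact: DF.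
apply: (@le0_of_eps _ _ ((b - a) ^+ 2 + (d - c) ^+ 2)) => e e0.
pose P a b c d := rnorm (contour F a b c d) <= e * ((b - a) ^+ 2 + (d - c) ^+ 2).
apply: (@rectangle_bisection _ P) => //.
- move=> a' b' c' d' aa ab' bb cc cd' dd p q.
  rewrite /P (@contour_quarters F a' p b' c' q d'); try by rewrite /p /q; lra.
    move=> P1 P2 P3 P4.
    apply: le_trans (rnormD _ _) _; apply: le_trans (lerD (rnormD _ _) (rnormD _ _)) _.
    have -> : e * ((b' - a') ^+ 2 + (d' - c') ^+ 2) =
      (e * ((p - a') ^+ 2 + (q - c') ^+ 2) + e * ((b' - p) ^+ 2 + (q - c') ^+ 2)) +
      (e * ((p - a') ^+ 2 + (d' - q) ^+ 2) + e * ((b' - p) ^+ 2 + (d' - q) ^+ 2)).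
      by rewrite /p /q; field.
    by apply: lerD; apply: lerD.
  by move=> x y /andP[? ?] /andP[? ?]; apply: CF; apply/andP; split; lra.
move=> x y xab ycd; have [l lP] := DF x y xab ycd.
have e8 : 0 < e / 8 by rewrite divr_gt0.
have [t t0 tP] := lP _ e8; exists (t / 2); first by rewrite divr_gt0.
move=> a' b' c' d' aa xab' bb cc ycd' dd bta dtc.
have ab' : a' <= b' by case/andP: xab'; exact: le_trans.
have cd' : c' <= d' by case/andP: ycd'; exact: le_trans.
set D := (b' - a') + (d' - c').
have Dt : D < t by rewrite /D; lra.
have CF' x' y' : frame a' b' c' d' x' y' -> cont_at F (x' +i* y').
  move=> /(frame_rect ab' cd')[/andP[? ?] /andP[? ?]].
  by apply: CF; apply/andP; split; lra.
rewrite /P; pose k := F (x +i* y) - l * (x +i* y).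
have -> : contour F a' b' c' d' = contour (fun z => F z + (- k + (- l) * z)) a' b' c' d'.
  by rewrite contourD// ?contour_affine// ?addr0// => *; exact: cont_at_affine.
apply: (@le_trans _ _ (4 * (e / 8 * D) * D)).
  apply: contour_bound => // x' y' xy.
    move=> h h0; have h2 : 0 < h / 2 by rewrite divr_gt0.
    have [u u0 uP] := CF' _ _ xy _ h2.
    have [v v0 vP] := @cont_at_affine (- k) (- l) (x' +i* y') _ h2.
    exists (Num.min u v); first by rewrite lt_min u0.
    move=> w; rewrite lt_min => /andP[/uP wu /vP wv].
    rewrite (_ : _ - _ = (F w - F (x' +i* y')) + ((- k + - l * w) - (- k + - l * (x' +i* y')))).
      apply: le_lt_trans (rnormD _ _) _.
      by rewrite [h]splitr ltrD.
    by ring.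
  have [x'ab y'cd] := frame_rect ab' cd' xy.
  have nD := dist_in_rectangle xab' ycd' x'ab y'cd.
  have -> : F (x' +i* y') + (- k + (- l) * (x' +i* y')) =
    F (x' +i* y') - F (x +i* y) - l * ((x' +i* y') - (x +i* y)) by rewrite /k; ring.
  apply: le_trans (tP _ _) _; last by rewrite ler_pM2l.
  exact: le_lt_trans nD Dt.
have -> : 4 * (e / 8 * D) * D = e * (D ^+ 2 / 2) by field.
rewrite ler_pM2l// /D; have := sqr_ge0 ((b' - a') - (d' - c')).
by rewrite !expr2; lra.
Qed.

(** The region between the two rectangles is cut into four rectangles, on each of
    which Goursat's theorem applies. *)
Theorem contour_deform F a b c d a' b' c' d' :
  a <= a' -> a' <= b' -> b' <= b -> c <= c' -> c' <= d' -> d' <= d ->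
  (forall x y, a <= x <= b -> c <= y <= d -> [\/ x <= a', b' <= x, y <= c' | d' <= y] ->
    cderivable F (x +i* y)) ->
  contour F a b c d = contour F a' b' c' d'.
Proof.
move=> aa ab bb cc cd dd DF.
have DF1 x y : a <= x <= a' -> c <= y <= d -> cderivable F (x +i* y).
  by move=> /andP[? ?] ?; apply: DF => //; [apply/andP; split; lra|constructor 1].
have DF2 x y : b' <= x <= b -> c <= y <= d -> cderivable F (x +i* y).
  by move=> /andP[? ?] ?; apply: DF => //; [apply/andP; split; lra|constructor 2].
have DF3 x y : a <= x <= b -> c <= y <= c' -> cderivable F (x +i* y).
  by move=> ? /andP[? ?]; apply: DF => //; [apply/andP; split; lra|constructor 3].
have DF4 x y : a <= x <= b -> d' <= y <= d -> cderivable F (x +i* y).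
  by move=> ? /andP[? ?]; apply: DF => //; [apply/andP; split; lra|constructor 4].
clear DF.
have ab' : a' <= b by exact: le_trans bb.
have ba' : a <= b' by exact: le_trans ab.
have cd' : c' <= d by exact: le_trans dd.
have dc' : c <= d' by exact: le_trans cd.
have ab0 : a <= b by exact: le_trans ab'.
have cd0 : c <= d by exact: le_trans cd'.
have H y : (c <= y <= c') \/ (d' <= y <= d) -> forall x, a <= x <= b -> cont_at F (x +i* y).
  by move=> yP x xP; apply: cderivable_cont; case: yP => yP; [exact: DF3|exact: DF4].
have V x : (a <= x <= a') \/ (b' <= x <= b) -> forall y, c <= y <= d -> cont_at F (x +i* y).
  by move=> xP y yP; apply: cderivable_cont; case: xP => xP; [exact: DF1|exact: DF2].
have Hc : c <= c <= c' by rewrite lexx.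
have Hc' : c <= c' <= c' by rewrite lexx andbT.
have Hd' : d' <= d' <= d by rewrite lexx.
have Hd : d' <= d <= d by rewrite lexx andbT.
have Va : a <= a <= a' by rewrite lexx.
have Va' : a <= a' <= a' by rewrite lexx andbT.
have Vb' : b' <= b' <= b by rewrite lexx.
have Vb : b' <= b <= b by rewrite lexx andbT.
have subx x u v : a <= u -> v <= b -> u <= x <= v -> a <= x <= b.
  by move=> au vb /andP[ux xv]; rewrite (le_trans au) ?(le_trans xv).
have suby y u v : c <= u -> v <= d -> u <= y <= v -> c <= y <= d.
  by move=> au vb /andP[ux xv]; rewrite (le_trans au) ?(le_trans xv).
rewrite (@contour_cat_x F a a' b c d)//; last 5 first.
- by apply: H; auto.
- by apply: H; auto.
- by apply: V; auto.
- by apply: V; auto.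
- by apply: V; auto.
rewrite (@contour_cat_x F a' b' b c d)//; last 5 first.
- by move=> x /(subx _ _ _ aa (lexx b)); apply: H; auto.
- by move=> x /(subx _ _ _ aa (lexx b)); apply: H; auto.
- by apply: V; auto.
- by apply: V; auto.
- by apply: V; auto.
rewrite (@contour_cat_y F a' b' c c' d)//; last 5 first.
- by move=> x /(subx _ _ _ aa bb); apply: H; auto.
- by move=> x /(subx _ _ _ aa bb); apply: H; auto.
- by move=> x /(subx _ _ _ aa bb); apply: H; auto.
- by apply: V; auto.
- by apply: V; auto.
rewrite (@contour_cat_y F a' b' c' d' d)//; last 5 first.
- by move=> x /(subx _ _ _ aa bb); apply: H; auto.
- by move=> x /(subx _ _ _ aa bb); apply: H; auto.
- by move=> x /(subx _ _ _ aa bb); apply: H; auto.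
- by move=> y /(suby _ _ _ cc (lexx d)); apply: V; auto.
- by move=> y /(suby _ _ _ cc (lexx d)); apply: V; auto.
rewrite (@goursat F a a' c d)// (@goursat F b' b c d)//.
rewrite (@goursat F a' b' c c')//; last by move=> x y /(subx _ _ _ aa bb); exact: DF3.
rewrite (@goursat F a' b' d' d)//; last by move=> x y /(subx _ _ _ aa bb); exact: DF4.
by rewrite !add0r !addr0.
Qed.

End Contour.

(** * Cauchy's formula and the Schwarz estimate *)

Section CauchyEstimates.
Context {R : realType}.
Implicit Types (F G k : R[i] -> R[i]) (z w p : R[i]) (a b c d s : R).

Lemma pt_neq x y p : (x != complex.Re p) || (y != complex.Im p) -> x +i* y != p.
Proof. by case: p => u v /=; rewrite eq_complex /= negb_and. Qed.

Lemma small_square a b c d p (e : R) : a < complex.Re p < b -> c < complex.Im p < d -> 0 < e ->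
  exists s, [/\ 0 < s, s < e, a <= complex.Re p - s /\ complex.Re p + s <= b &
    c <= complex.Im p - s /\ complex.Im p + s <= d].
Proof.
move=> /andP[ap pb] /andP[cp pd] e0.
set u := complex.Re p in ap pb *; set v := complex.Im p in cp pd *.
exists (Num.min (Num.min (e / 2) (Num.min (u - a) (b - u))) (Num.min (v - c) (d - v))).
set m := Num.min _ _.
have : m <= m by []. 
rewrite {2}/m !le_min => /andP[/andP[m1 /andP[m2 m3]] /andP[m4 m5]].
split; [rewrite /m !lt_min !subr_gt0 divr_gt0//= ap pb cp pd//|lra|split; lra|split; lra].
Qed.

Lemma square_frame s p x y : 0 <= s ->
  frame (complex.Re p - s) (complex.Re p + s) (complex.Im p - s) (complex.Im p + s) x y ->
  s <= rnorm ((x +i* y) - p) /\ rnorm ((x +i* y) - p) <= 2 * s.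
Proof.
case: p => u v /= s0 xy.
have [/andP[x1 x2] /andP[y1 y2]] : u - s <= x <= u + s /\ v - s <= y <= v + s.
  by apply: frame_rect xy; lra.
split; last first.
  apply: le_trans (rnorm_pt_sub _ _ _ _) _; rewrite mulr2n mulrDl mul1r lerD// ler_norml; apply/andP; split; lra.
case: xy => [[_ xy]|[xy _]].
  apply: le_trans (Im_le_rnorm _); simpc => /=.
  by case: xy => ->; [have -> : v - s - v = - s by ring|have -> : v + s - v = s by ring]; rewrite ?normrN ler_norm.
apply: le_trans (Re_le_rnorm _); simpc => /=.
by case: xy => ->; [have -> : u - s - u = - s by ring|have -> : u + s - u = s by ring]; rewrite ?normrN ler_norm.
Qed.

Lemma contour_to_square G a b c d p s : 0 < s ->
  a <= complex.Re p - s /\ complex.Re p + s <= b ->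
  c <= complex.Im p - s /\ complex.Im p + s <= d ->
  (forall x y, a <= x <= b -> c <= y <= d -> x +i* y != p -> cderivable G (x +i* y)) ->
  contour G a b c d =
  contour G (complex.Re p - s) (complex.Re p + s) (complex.Im p - s) (complex.Im p + s).
Proof.
move=> s0 [a1 b1] [c1 d1] DG; apply: contour_deform => //; try lra.
move=> x y xab ycd H; apply: DG => //; apply: pt_neq.
by case: H => H; apply/orP; [left|left|right|right]; apply/eqP => E; move: H; rewrite E; lra.
Qed.

(** On a square of half-side s around p the integrand is at most e / s and the
    perimeter is 8 s, so the integral is O(e). *)
Lemma contour_removable G a b c d p : a < complex.Re p < b -> c < complex.Im p < d ->
  (forall x y, a <= x <= b -> c <= y <= d -> x +i* y != p -> cderivable G (x +i* y)) ->
  (forall e : R, 0 < e -> exists2 t : R, 0 < t & forall z, z != p -> rnorm (z - p) < t ->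
    rnorm (G z * (z - p)) <= e) ->
  contour G a b c d = 0.
Proof.
move=> pab pcd DG Gp; apply: rnorm_eq0; apply/eqP; rewrite eq_le rnorm_ge0 andbT.
apply: (@le0_of_eps _ _ 16) => e e0.
have [t t0 tP] := Gp e e0; have t2 : 0 < t / 2 by rewrite divr_gt0.
have [s [s0 st sab scd]] := small_square pab pcd t2.
rewrite (contour_to_square s0 sab scd DG).
have DG' x y : frame (complex.Re p - s) (complex.Re p + s) (complex.Im p - s) (complex.Im p + s) x y ->
  cderivable G (x +i* y).
  move=> xy; have [sxy _] := square_frame (ltW s0) xy.
  have [/andP[x1 x2] /andP[y1 y2]] :
      complex.Re p - s <= x <= complex.Re p + s /\ complex.Im p - s <= y <= complex.Im p + s.
    by apply: frame_rect xy; lra.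
  apply: DG; [by case: sab => *; apply/andP; split; lra|by case: scd => *; apply/andP; split; lra|].
  by apply/eqP => E; move: sxy; rewrite E subrr rnorm0 leNgt s0.
apply: le_trans (contour_bound (M := e / s) _ _ _ _) _; try lra.
- by move=> x y /DG'; exact: cderivable_cont.
- move=> x y xy; have [sxy sxy2] := square_frame (ltW s0) xy.
  have xyp : x +i* y != p.
    by apply/eqP => E; move: sxy; rewrite E subrr rnorm0 leNgt s0.
  have := tP _ xyp; rewrite rnormM.
  have /[swap]/[apply] : rnorm (x +i* y - p) < t by lra.
  move=> h; rewrite ler_pdivlMr//; apply: le_trans h.
  by rewrite ler_wpM2l// rnorm_ge0.
rewrite le_eqVlt; apply/orP; left; apply/eqP; field; lra.
Qed.

Lemma cderivable_pow n p z : z != p -> cderivable (fun w => (w - p)^-1 ^+ n) z.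
Proof.
move=> zp; elim: n => [|n IH]; first exact: cderivable_cst.
have -> : (fun w => (w - p)^-1 ^+ n.+1) = (fun w => (w - p)^-1 * (w - p)^-1 ^+ n).
  by apply/funext => w; rewrite exprS.
by apply: cderivableM => //; exact: cderivable_inv.
Qed.

(** The exact value is 2 pi i; a positive lower bound is enough to divide by it.
    Pairing opposite sides makes each integrand equal to 2 s / (s^2 + u^2), which
    is at least 1 / s on a segment of length 2 s. *)
Lemma winding_square p s : 0 < s ->
  4 <= complex.Im (contour (fun z => (z - p)^-1)
    (complex.Re p - s) (complex.Re p + s) (complex.Im p - s) (complex.Im p + s)).
Proof.
move=> s0; have ss : 0 < s^-1 by rewrite invr_gt0.
have bnd (u : R) : - s <= u <= s -> s^-1 <= 2 * s / (s ^+ 2 + u ^+ 2).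
  move=> us; have D0 : 0 < s ^+ 2 + u ^+ 2 by rewrite ltr_wpDr ?sqr_ge0// exprn_gt0.
  rewrite ler_pdivlMr// mulrC ler_pdivrMr// -mulrA -expr2.
  have : u ^+ 2 <= s ^+ 2 by rewrite -real_normK ?num_real// lerXn2r ?nnegrE ?normr_ge0 ?(ltW s0)// ler_norml.
  lra.
have CF x y : frame (complex.Re p - s) (complex.Re p + s) (complex.Im p - s) (complex.Im p + s) x y ->
    cont_at (fun z => (z - p)^-1) (x +i* y).
  move=> xy; have [sxy _] := square_frame (ltW s0) xy.
  apply: cderivable_cont; apply: cderivable_inv.
  by apply/eqP => E; move: sxy; rewrite E subrr rnorm0 leNgt s0.
have [C1 C2] := contour_path_cont CF.
rewrite /contour.
set I1 := path_integral _ _ _; set I2 := path_integral _ _ _.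
have [_ B1] : 0 * (complex.Re p + s - (complex.Re p - s)) <= complex.Re I1 /\
   s^-1 * (complex.Re p + s - (complex.Re p - s)) <= complex.Im I1.
  apply: path_integral_ge => //; first by lra.
    move=> x xs; case: p {CF C1 C2 I1 I2} xs => u v /= xs; simpc.
    rewrite le_eqVlt; apply/orP; left; apply/eqP.
    have -> : v - s - v = - s by ring.
    have -> : v + s - v = s by ring.
    by rewrite sqrrN subrr.
  move=> x xs; case: p {CF C1 C2 I1 I2} xs => u v /= xs; simpc.
  have -> : v - s - v = - s by ring.
  have -> : v + s - v = s by ring.
  apply: le_trans (bnd (x - u) _) _; first by lra.
  have D0 : 0 < (x - u) ^+ 2 + s ^+ 2 by rewrite ltr_wpDl ?sqr_ge0// exprn_gt0.
  rewrite sqrrN le_eqVlt; apply/orP; left; apply/eqP; field.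
  by rewrite gt_eqF//= addrC gt_eqF// addrC.
have [B2 _] : s^-1 * (complex.Im p + s - (complex.Im p - s)) <= complex.Re I2 /\
   0 * (complex.Im p + s - (complex.Im p - s)) <= complex.Im I2.
  apply: path_integral_ge => //; first by lra.
    move=> x xs; case: p {CF C1 C2 I1 I2 B1} xs => u v /= xs; simpc.
    have -> : u - s - u = - s by ring.
    have -> : u + s - u = s by ring.
    apply: le_trans (bnd (x - v) _) _; first by lra.
    have D0 : 0 < s ^+ 2 + (x - v) ^+ 2 by rewrite ltr_wpDr ?sqr_ge0// exprn_gt0.
    rewrite sqrrN le_eqVlt; apply/orP; left; apply/eqP; field.
    by rewrite gt_eqF.
  move=> x xs; case: p {CF C1 C2 I1 I2 B1} xs => u v /= xs; simpc.
  rewrite le_eqVlt; apply/orP; left; apply/eqP.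
  have -> : u - s - u = - s by ring.
  have -> : u + s - u = s by ring.
  by rewrite sqrrN; ring.
have -> : complex.Im (I1 + 'i%C * I2) = complex.Im I1 + complex.Re I2.
  by case: (I1) (I2) => ? ? [? ?] /=; simpc.
have E u : s^-1 * (u + s - (u - s)) = 2 by field; lra.
by move: B1 B2; rewrite !E; lra.
Qed.

(** The quotient (k z - k p) / (z - p) has a removable singularity at p. *)
Lemma cauchy_formula k a b c d p : a < complex.Re p < b -> c < complex.Im p < d ->
  (forall x y, a <= x <= b -> c <= y <= d -> cderivable k (x +i* y)) ->
  contour (fun z => k z * (z - p)^-1) a b c d = k p * contour (fun z => (z - p)^-1) a b c d.
Proof.
move=> pab pcd Dk.
have [ab cd] : a <= b /\ c <= d by case/andP: pab; case/andP: pcd => *; split; lra.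
have Dk' x y : frame a b c d x y -> cderivable k (x +i* y).
  by move=> /(frame_rect ab cd)[? ?]; exact: Dk.
have Di x y : frame a b c d x y -> cderivable (fun z => (z - p)^-1) (x +i* y).
  move=> xy; apply: cderivable_inv; apply: pt_neq; apply/orP.
  case: xy => [[_ yE]|[xE _]]; [right|left]; apply/eqP => E.
    by case: yE => yE; move: pcd; rewrite -E yE ltxx ?andbF.
  by case: xE => xE; move: pab; rewrite -E xE ltxx ?andbF.
apply/eqP; rewrite -subr_eq0; apply/eqP.
rewrite -(@contour_removable (fun z => (k z - k p) * (z - p)^-1) a b c d p)//.
- rewrite -mulNr -contourZ -?contourD.
  + by apply: eq_contour => x y _; ring.
  + by move=> x y xy; apply: cderivable_cont; apply: cderivableM; [exact: Dk'|exact: Di].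
  + by move=> x y xy; apply: cderivable_cont; apply: cderivableM; [exact: cderivable_cst|exact: Di].
  + by move=> x y xy; apply: cderivable_cont; exact: Di.
- move=> x y xab ycd xyp; apply: cderivableM; last exact: cderivable_inv.
  by apply: cderivableB; [exact: Dk|exact: cderivable_cst].
- move=> e e0; have := @cderivable_cont _ k p; case: p pab pcd Di => u v /= /andP[? ?] /andP[? ?] _.
  move=> /(_ (Dk _ _ _ _) e e0)[||t t0 tP]; try by apply/andP; split; lra.
  exists t => // z zp zt; rewrite mulfVK ?subr_eq0//.
  by rewrite ltW// tP.
Qed.

(** Dividing k by z^j leaves a removable singularity at 0 as long as j < n, so
    the identity p / (z^(j+1) (z - p)) = 1 / (z^j (z - p)) - 1 / z^(j+1) can be
    iterated in Cauchy's formula.  It yields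
      k(p) W = p^n * integral of k(z) / (z^n (z - p)),
    with |W| >= 4, |z| >= s and |z - p| >= s/2 on the contour, which is the square
    of half-side s. *)
Theorem schwarz_order k s (M : R) n p : 0 < s ->
  (forall z, rnorm z <= 2 * s -> cderivable k z) ->
  (forall z, rnorm z <= 2 * s -> rnorm (k z) <= M) ->
  (forall j, (j < n)%N -> forall e : R, 0 < e -> exists2 t : R, 0 < t &
    forall z, rnorm z < t -> rnorm (k z) <= e * rnorm z ^+ j) ->
  p != 0 -> rnorm p <= s / 2 -> rnorm (k p) <= 8 * M * (rnorm p / s) ^+ n.
Proof.
move=> s0 Dk kM ko p0 ps.
have s20 : 0 < s / 2 by rewrite divr_gt0.
have inD x y : - s <= x <= s -> - s <= y <= s -> rnorm (x +i* y : R[i]) <= 2 * s.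
  move=> /andP[? ?] /andP[? ?]; apply: le_trans (rnorm_le_ReIm _) _ => /=.
  by rewrite mulr2n mulrDl mul1r lerD// ler_norml; apply/andP; split.
have ss : - s <= s by lra.
have Fs x y : frame (- s) s (- s) s x y -> s <= rnorm (x +i* y : R[i]).
  move=> xy; have := @square_frame s 0 x y (ltW s0); rewrite /= !sub0r !add0r subr0.
  by move=> /(_ xy)[].
have ReP : - s < complex.Re p < s.
  have := Re_le_rnorm p; rewrite ler_norml => /andP[? ?]; apply/andP; split; lra.
have ImP : - s < complex.Im p < s.
  have := Im_le_rnorm p; rewrite ler_norml => /andP[? ?]; apply/andP; split; lra.
have Re0 : - s < complex.Re (0 : R[i]) < s by rewrite /= oppr_lt0 s0.
have Im0 : - s < complex.Im (0 : R[i]) < s by rewrite /= oppr_lt0 s0.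
have far x y : frame (- s) s (- s) s x y -> s / 2 <= rnorm (x +i* y - p).
  move=> /Fs xys; have := rnormD (x +i* y - p) p; rewrite subrK; lra.
have ne0 x y : frame (- s) s (- s) s x y -> x +i* y != 0.
  by move=> /Fs xys; apply/eqP => E; move: xys; rewrite E rnorm0 leNgt s0.
have nep x y : frame (- s) s (- s) s x y -> x +i* y != p.
  by move=> /far xys; apply/eqP => E; move: xys; rewrite E subrr rnorm0 leNgt s20.
pose G j (z : R[i]) := k z * (z - 0)^-1 ^+ j.
have DG j z : rnorm z <= 2 * s -> z != 0 -> cderivable (G j) z.
  by move=> zs z0; apply: cderivableM; [exact: Dk|exact: cderivable_pow].
have DF x y : frame (- s) s (- s) s x y -> forall j, cderivable (G j) (x +i* y).
  move=> xy j; apply: DG; last exact: ne0.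
  by have [? ?] := frame_rect ss ss xy; exact: inD.
have DI x y : frame (- s) s (- s) s x y -> forall j, cderivable (fun z => G j z * (z - p)^-1) (x +i* y).
  by move=> xy j; apply: cderivableM; [exact: DF|apply: cderivable_inv; exact: nep].
pose I j := contour (fun z => G j z * (z - p)^-1) (- s) s (- s) s.
have IS j : (j < n)%N -> I j = p * I j.+1.
  move=> jn; have Gint : contour (G j.+1) (- s) s (- s) s = 0.
    apply: (@contour_removable _ _ _ _ _ 0) => //.
      by move=> x y ? ? xy0; apply: DG => //; exact: inD.
    move=> e e0; have [t t0 tP] := ko j jn e e0; exists t => // z z0; rewrite subr0 => zt.
    rewrite /G subr0 exprSr mulrA mulfVK// rnormM rnormX rnormV.
    by rewrite exprVn ler_pdivrMr ?exprn_gt0 ?rnorm_gt0// tP.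
  apply/eqP; rewrite -subr_eq0 -[X in _ == X]Gint /I -mulNr -contourZ ?mulNr.
    rewrite -contourD.
    + apply/eqP; apply: eq_contour => x y xy; rewrite /G subr0 exprSr.
      have h1 := ne0 _ _ xy; have h2 := nep _ _ xy.
      by field; rewrite h1 subr_eq0 h2.
    + by move=> x y xy; apply: cderivable_cont; exact: DI.
    + move=> x y xy; apply: cderivable_cont; apply: cderivableM; last exact: DI.
      exact: cderivable_cst.
  by move=> x y xy; apply: cderivable_cont; exact: DI.
have I0 j : (j <= n)%N -> I 0%N = p ^+ j * I j.
  elim: j => [|j IH] jn; first by rewrite expr0 mul1r.
  by apply: (etrans (IH (ltnW jn))); rewrite exprSr -mulrA; apply: (f_equal (GRing.mul _)); exact: IS.
set W := contour (fun z => (z - p)^-1) (- s) s (- s) s.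
have W4 : 4 <= rnorm W.
  apply: le_trans (Im_le_rnorm _); apply: le_trans (ler_norm _).
  have [t [t0 _ tab tcd]] := small_square ReP ImP ltr01.
  rewrite /W (contour_to_square t0 tab tcd); first exact: winding_square.
  by move=> x y _ _; exact: cderivable_inv.
have kW : k p * W = p ^+ n * I n.
  rewrite /W -cauchy_formula//.
    apply: (etrans _ (I0 n (leqnn n))).
    by apply: eq_contour => x y _; rewrite /G expr0 mulr1.
  by move=> x y ? ?; apply: Dk; exact: inD.
have In : rnorm (I n) <= 4 * (M / s ^+ n / (s / 2)) * ((s - - s) + (s - - s)).
  apply: contour_bound => //.
    by move=> x y xy; apply: cderivable_cont; exact: DI.
  move=> x y xy; rewrite /G subr0 !rnormM rnormX !rnormV.
  have [xab yab] := frame_rect ss ss xy.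
  have M0 := kM _ (inD _ _ xab yab).
  have xyn : s ^+ n <= rnorm (x +i* y : R[i]) ^+ n.
    by rewrite lerXn2r ?nnegrE ?rnorm_ge0 ?(ltW s0)// Fs.
  have sn0 : 0 < s ^+ n by rewrite exprn_gt0.
  have xyp := far _ _ xy.
  apply: ler_pM; rewrite ?mulr_ge0 ?invr_ge0 ?exprn_ge0 ?invr_ge0 ?rnorm_ge0//.
    rewrite ler_pM ?rnorm_ge0 ?exprn_ge0 ?invr_ge0 ?rnorm_ge0//.
    by rewrite exprVn lef_pV2// posrE// (lt_le_trans sn0).
  by rewrite lef_pV2// posrE// (lt_le_trans s20).
have kp0 := rnorm_ge0 (k p).
have h : 4 * rnorm (k p) <= 32 * M * (rnorm p / s) ^+ n.
  apply: (@le_trans _ _ (rnorm (k p) * rnorm W)); first by rewrite mulrC ler_wpM2l.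
  rewrite -rnormM kW rnormM rnormX.
  apply: le_trans (ler_wpM2l _ In) _; first by rewrite exprn_ge0// rnorm_ge0.
  have sn0 : s ^+ n != 0 by rewrite expf_neq0// gt_eqF.
  rewrite le_eqVlt; apply/orP; left; apply/eqP; rewrite expr_div_n.
  by field; rewrite sn0 gt_eqF.
by rewrite -(@ler_pM2l _ 4)//; apply: le_trans h _; lra.
Qed.

End CauchyEstimates.

(** * Holomorphic maps of several variables *)

Section VectorEstimates.
Context {R : realType} {n : nat}.
Notation V := 'cV[R[i]]_n.
Implicit Types (g : V -> V) (p q v z : V).

Lemma rnorm_coord v i : rnorm (v i 0) <= rnorm v.
Proof.
rewrite -lecR -!rnormE -[X in _ <= X]/(mx_norm v) mx_normE.
by rewrite -[leLHS]nngE num_le; exact: (le_bigmax _ _ (i, 0)).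
Qed.

Lemma rnorm_le_coord v (K : R) : 0 <= K -> (forall i, rnorm (v i 0) <= K) -> rnorm v <= K.
Proof.
move=> K0 H; rewrite -lecR -rnormE -[X in X <= _]/(mx_norm v) mx_normE.
have KC0 : 0 <= K%:C by rewrite lecR.
rewrite -[K%:C]/((NngNum KC0)%:num) num_le; apply/bigmax_leP; split=> //.
by move=> [i j] _; rewrite ord1; have : `|v i 0| <= K%:C by rewrite rnormE lecR.
Qed.

(** Homogeneity of L lets differentiability pass to complex lines, and its
    boundedness makes g locally Lipschitz at q. *)
Definition vderivable g q := exists L : V -> V,
  [/\ forall a v, L (a *: v) = a *: L v,
      exists2 K : R, 0 <= K & forall v, rnorm (L v) <= K * rnorm v &
      forall e : R, 0 < e -> exists2 d : R, 0 < d & forall q', rnorm (q' - q) < d ->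
        rnorm (g q' - g q - L (q' - q)) <= e * rnorm (q' - q)].

Lemma linear_continuous_bounded (L : {linear V -> V}) : continuous L ->
  exists2 K : R, 0 <= K & forall v, rnorm (L v) <= K * rnorm v.
Proof.
move=> /(_ 0)/(_ [set w | rnorm (w - L 0) < 1]).
case/(_ _)/nbhs_rnormP => [|d d0 dP]; first by apply/nbhs_rnormP; exists 1.
exists (2 / d); first by rewrite divr_ge0// ltW.
move=> v; have [->|v0] := eqVneq v 0; first by rewrite linear0 rnorm0 mulr0.
have nv := rnorm_gt0 v0; pose a : R := d / (2 * rnorm v).
have a0 : 0 < a by rewrite divr_gt0// mulr_gt0.
have := dP (a%:C *: v); rewrite /= linear0 !subr0 linearZ /= !rnormZ rnormR gtr0_norm//.
have E : a * rnorm v = d / 2 by rewrite /a; field; rewrite gt_eqF.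
rewrite E => /(_ _) H; have /H : d / 2 < d by lra.
rewrite mulrC -ltr_pdivlMr// div1r /a invf_div => /ltW /le_trans; apply.
by rewrite mulrAC.
Qed.

Lemma differentiable_vderivable g q : differentiable g q -> vderivable g q.
Proof.
move=> dg; exists ('d g q); split.
- by move=> a v; rewrite linearZ.
- by apply: linear_continuous_bounded; exact: diff_continuous.
- exact: differentiable_rnorm.
Qed.

Lemma vderivable_lip g q : vderivable g q ->
  exists2 K : R, 0 < K & exists2 d : R, 0 < d & forall z, rnorm (z - q) < d ->
    rnorm (g z - g q) <= K * rnorm (z - q).
Proof.
move=> [L [_ [K K0 LK] /(_ 1 ltr01)[d d0 dP]]]; exists (1 + K); first by rewrite ltr_wpDr.
exists d => // z /dP h.
rewrite -[g z - g q](subrK (L (z - q))).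
by apply: le_trans (rnormD _ _) _; rewrite mulrDl lerD.
Qed.

Lemma vderivable_cst p q : vderivable (fun=> p) q.
Proof.
exists (fun=> 0); split; first by move=> a v; rewrite scaler0.
- by exists 0 => // v; rewrite rnorm0 mul0r.
- move=> e e0; exists 1 => // q' _; rewrite subrr subr0 rnorm0 mulr_ge0 ?rnorm_ge0//.
  exact: ltW.
Qed.

Lemma mulmx_bounded (A : 'M[R[i]]_n) :
  exists2 K : R, 0 <= K & forall v, rnorm (A *m v) <= K * rnorm v.
Proof.
exists (\sum_i \sum_j rnorm (A i j)).
  by apply: sumr_ge0 => i _; apply: sumr_ge0 => j _; exact: rnorm_ge0.
move=> v; apply: rnorm_le_coord.
  rewrite mulr_ge0 ?rnorm_ge0//.
  by apply: sumr_ge0 => i _; apply: sumr_ge0 => j _; exact: rnorm_ge0.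
move=> i; rewrite mxE [X in _ <= X * _](bigD1 i)//= mulrDl ler_wpDr//.
  rewrite mulr_ge0 ?rnorm_ge0//.
  by apply: sumr_ge0 => k _; apply: sumr_ge0 => j _; exact: rnorm_ge0.
rewrite mulr_suml; apply: (big_ind2 (fun (x : R[i]) (y : R) => rnorm x <= y)).
- by rewrite rnorm0.
- by move=> x1 y1 x2 y2 h1 h2; apply: le_trans (rnormD _ _) _; exact: lerD.
- by move=> j _; rewrite rnormM ler_wpM2l ?rnorm_ge0// rnorm_coord.
Qed.

Lemma vderivable_mulmx (A : 'M[R[i]]_n) q : vderivable (mulmx A) q.
Proof.
exists (mulmx A); split; first by move=> a v; rewrite scalemxAr.
- exact: mulmx_bounded.
- move=> e e0; exists 1 => // q' _; rewrite -mulmxBr subrr rnorm0 mulr_ge0 ?rnorm_ge0//.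
  exact: ltW.
Qed.

Lemma vderivableB g h q : vderivable g q -> vderivable h q -> vderivable (fun z => g z - h z) q.
Proof.
move=> [L [LZ [K K0 LK] LP]] [L' [LZ' [K' K'0 LK'] LP']]; exists (fun z => L z - L' z); split.
- by move=> a v; rewrite LZ LZ' scalerBr.
- exists (K + K'); first exact: addr_ge0.
  by move=> v; apply: le_trans (rnormD _ _) _; rewrite rnormN mulrDl lerD.
move=> e e0; have e2 : 0 < e / 2 by rewrite divr_gt0.
have [d d0 dP] := LP _ e2; have [d' d'0 d'P] := LP' _ e2.
exists (Num.min d d'); first by rewrite lt_min d0.
move=> q'; rewrite lt_min => /andP[/dP h1 /d'P h2].
have -> : g q' - h q' - (g q - h q) - (L (q' - q) - L' (q' - q)) =
  (g q' - g q - L (q' - q)) - (h q' - h q - L' (q' - q)).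
  by apply/matrixP => i j; rewrite !mxE; ring.
by apply: le_trans (rnormD _ _) _; rewrite rnormN; lra.
Qed.

Lemma vderivable_slice g p v (a : R[i]) i : vderivable g (p + a *: v) ->
  cderivable (fun w => g (p + w *: v) i 0) a.
Proof.
move=> [L [LZ _ LP]]; exists (L v i 0) => e e0.
have v1 : 0 < rnorm v + 1 by have := rnorm_ge0 v; lra.
have [d d0 dP] := LP (e / (rnorm v + 1)) (divr_gt0 e0 v1).
exists (d / (rnorm v + 1)); first by rewrite divr_gt0.
move=> w; rewrite ltr_pdivlMr// => wd.
have E : p + w *: v - (p + a *: v) = (w - a) *: v.
  by rewrite scalerBl opprD addrACA subrr add0r.
have w0 := rnorm_ge0 (w - a).
have := dP (p + w *: v); rewrite E rnormZ LZ => /(_ _) H.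
have /H {}H : rnorm (w - a) * rnorm v < d.
  by apply: le_lt_trans wd; rewrite ler_wpM2l// lerDl.
have -> : g (p + w *: v) i 0 - g (p + a *: v) i 0 - L v i 0 * (w - a) =
  (g (p + w *: v) - g (p + a *: v) - (w - a) *: L v) i 0 by rewrite !mxE; ring.
apply: le_trans (rnorm_coord _ i) (le_trans H _).
have -> : e / (rnorm v + 1) * (rnorm (w - a) * rnorm v) =
  e * rnorm (w - a) * (rnorm v / (rnorm v + 1)) by field; rewrite gt_eqF.
rewrite ler_piMr ?mulr_ge0 ?(ltW e0)//.
by rewrite ler_pdivrMr// mul1r lerDl.
Qed.

(** The one-variable estimate on the complex line through p and q. *)
Lemma vector_schwarz g p q (s M : R) m : 0 < s ->
  (forall z, rnorm (z - p) <= 2 * s -> vderivable g z) ->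
  (forall z, rnorm (z - p) <= 2 * s -> rnorm (g z) <= M) ->
  (forall j, (j < m)%N -> forall e : R, 0 < e -> exists2 t : R, 0 < t &
    forall z, rnorm (z - p) < t -> rnorm (g z) <= e * rnorm (z - p) ^+ j) ->
  q != p -> rnorm (q - p) <= s / 2 -> rnorm (g q) <= 8 * M * (rnorm (q - p) / s) ^+ m.
Proof.
move=> s0 Dg gM go qp qs; set d := rnorm (q - p).
have d0 : 0 < d by rewrite rnorm_gt0// subr_eq0.
have dC : d%:C != 0 by rewrite -[0]/(0%:C) (inj_eq (@complexI _)) gt_eqF.
pose v := d%:C^-1 *: (q - p).
have v1 : rnorm v = 1 by rewrite rnormZ rnormV rnormR gtr0_norm// mulVf// gt_eqF.
have wv (w : R[i]) : rnorm (p + w *: v - p) = rnorm w.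
  by rewrite addrC addKr rnormZ v1 mulr1.
have qE : q = p + d%:C *: v by rewrite scalerA divff// scale1r addrC subrK.
have M0 : 0 <= M.
  by apply: le_trans (gM p _); [exact: rnorm_ge0|rewrite subrr rnorm0 mulr_ge0// ltW].
apply: rnorm_le_coord.
  by rewrite mulr_ge0 ?mulr_ge0// exprn_ge0// divr_ge0 ?ltW.
move=> i; have -> : d = rnorm (d%:C) by rewrite rnormR gtr0_norm.
rewrite [in X in rnorm X]qE.
apply: (@schwarz_order _ (fun w => g (p + w *: v) i 0)) => //.
- by move=> z zs; apply: vderivable_slice; apply: Dg; rewrite wv.
- by move=> z zs; apply: le_trans (rnorm_coord _ _) _; apply: gM; rewrite wv.
- move=> j jm e e0; have [t t0 tP] := go j jm e e0; exists t => // z zt.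
  by apply: le_trans (rnorm_coord _ _) _; rewrite -(wv z); apply: tP; rewrite wv.
- by rewrite rnormR gtr0_norm.
Qed.

(** A substitute for continuity of the derivative at 0.  On the ball of radius 9 d
    the remainder f - A is at most 9 d e / 20, and the first-order Schwarz estimate
    around x, with radius proportional to d, converts this size into a Lipschitz
    constant. *)
Lemma strict_derivative f (A : 'M[R[i]]_n) (r : R) : 0 < r -> f 0 = 0 ->
  (forall z, rnorm z < r -> vderivable f z) ->
  (forall e : R, 0 < e -> exists2 d : R, 0 < d & forall z, rnorm z < d ->
    rnorm (f z - A *m z) <= e * rnorm z) ->
  forall e : R, 0 < e -> exists2 d : R, 0 < d & forall x y, rnorm x < d -> rnorm y < d ->
    rnorm (f x - f y - A *m (x - y)) <= e * rnorm (x - y).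
Proof.
move=> r0 f0 Df fA e e0; have e20 : 0 < e / 20 by rewrite divr_gt0.
have [t t0 tP] := fA _ e20.
(* The estimate around x uses the disc of radius 2 (4 d), which together with |x| < d
   reaches up to 9 d. *)
pose d := Num.min r t / 18.
have m0 : 0 < Num.min r t by rewrite lt_min r0.
have d0 : 0 < d by rewrite divr_gt0.
have [dr dt] : 9 * d < r /\ 9 * d < t.
  rewrite /d; have : Num.min r t <= r /\ Num.min r t <= t by split; rewrite ge_min lexx ?orbT.
  by move=> []; lra.
exists d => // x y xd yd.
have [->|yx] := eqVneq y x; first by rewrite !subrr mulmx0 subr0 rnorm0 mulr0.
pose k z := f z - A *m z - (f x - A *m x).
have -> : f x - f y - A *m (x - y) = - k y.
  by rewrite /k mulmxBr; apply/matrixP => i j; rewrite !mxE; ring.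
rewrite rnormN [rnorm (x - y)]rnormB.
have xx z : rnorm (z - x) <= 2 * (4 * d) -> rnorm z < 9 * d.
  by move=> zx; have := rnormD (z - x) x; rewrite subrK; lra.
have d4 : 0 < 4 * d by rewrite mulr_gt0.
have e200 : 0 <= e / 20 by exact: ltW.
have := @vector_schwarz k x y (4 * d) (e / 2 * d) 1 d4 _ _ _ yx.
have -> : 8 * (e / 2 * d) * (rnorm (y - x) / (4 * d)) ^+ 1 = e * rnorm (y - x).
  by rewrite expr1; field; lra.
apply.
- move=> z /xx zd; apply: vderivableB; last exact: vderivable_cst.
  by apply: vderivableB; [apply: Df; lra|exact: vderivable_mulmx].
- move=> z /xx zd; apply: le_trans (rnormD _ _) _; rewrite rnormN.
  have h1 : rnorm (f z - A *m z) <= e / 20 * (9 * d).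
    apply: le_trans (tP _ _) _; first by lra.
    by rewrite ler_wpM2l// ltW.
  have h2 : rnorm (f x - A *m x) <= e / 20 * d.
    apply: le_trans (tP _ _) _; first by lra.
    by rewrite ler_wpM2l// ltW.
  by apply: le_trans (lerD h1 h2) _; rewrite le_eqVlt; apply/orP; left; apply/eqP; field.
- move=> [|//] _ h h0.
  have /vderivable_lip[K K0 [u u0 uP]] : vderivable k x.
    apply: vderivableB; last exact: vderivable_cst.
    by apply: vderivableB; [apply: Df; lra|exact: vderivable_mulmx].
  exists (Num.min u (h / K)); first by rewrite lt_min u0 divr_gt0.
  move=> z; rewrite lt_min ltr_pdivlMr// mulr1 => /andP[/uP].
  have -> : k x = 0 by rewrite /k subrr.
  rewrite subr0 => kz zK; apply: le_trans kz _; rewrite mulrC; exact: ltW.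
- have := rnormD y (- x); rewrite rnormN; lra.
Qed.

Lemma quadratic_bound g (r : R) : 0 < r ->
  (forall z, rnorm z < r -> vderivable g z) ->
  (forall e : R, 0 < e -> exists2 d : R, 0 < d & forall z, rnorm z < d ->
    rnorm (g z) <= e * rnorm z) ->
  exists2 C : R, 0 < C & exists2 d : R, 0 < d & forall z, rnorm z < d ->
    rnorm (g z) <= C * rnorm z ^+ 2.
Proof.
move=> r0 Dg go; have [t t0 tP] := go 1 ltr01.
pose s := Num.min r t / 4.
have m0 : 0 < Num.min r t by rewrite lt_min r0.
have s0 : 0 < s by rewrite divr_gt0.
have [sr st] : 2 * s < r /\ 2 * s < t.
  rewrite /s; have : Num.min r t <= r /\ Num.min r t <= t by split; rewrite ge_min lexx ?orbT.
  by move=> []; lra.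
exists (8 * (2 * s) / s ^+ 2); first by rewrite divr_gt0 ?mulr_gt0// exprn_gt0.
exists (s / 2); first by rewrite divr_gt0.
move=> z zs; have [->|z0] := eqVneq z 0.
  have := tP 0; rewrite rnorm0 !mul1r expr0n mulr0 => /(_ t0) //.
have -> : 8 * (2 * s) / s ^+ 2 * rnorm z ^+ 2 = 8 * (2 * s) * (rnorm (z - 0) / s) ^+ 2.
  by rewrite subr0; field; rewrite gt_eqF.
apply: vector_schwarz => //.
- by move=> w; rewrite subr0 => ws; apply: Dg; lra.
- by move=> w; rewrite subr0 => ws; apply: le_trans (tP _ _) _; rewrite ?mul1r//; lra.
- move=> [|[|//]] _ e e0.
    exists (Num.min t e); first by rewrite lt_min t0.
    by move=> w; rewrite subr0 lt_min => /andP[/tP wt we]; rewrite expr0 mulr1; lra.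
  have [u u0 uP] := go e e0; exists u => // w; rewrite subr0 expr1; exact: uP.
- by rewrite subr0 ltW.
Qed.

Lemma pow_half_limit0 (x M : R) : (forall m, x <= M * (1 / 2) ^+ m) -> x <= 0.
Proof.
move=> H; apply: (@le0_of_eps _ _ 1) => e e0; rewrite mulr1.
have [m mP] := half_pow_small M e0.
by apply: le_trans (H m) _; rewrite mul1r exprVn ltW.
Qed.

(** The set Z of points near which g vanishes is open; its closure does not leave it
    inside D.  Indeed, around a limit point p the map g is bounded, and from a
    nearby w in Z, where g vanishes to every order, the Schwarz estimate bounds g
    near p by a multiple of 2^-m for every m. *)
Theorem identity_theorem (D : set V) g : open D -> connected D ->
  (forall z, D z -> vderivable g z) ->
  D 0 -> (exists2 r : R, 0 < r & forall z, rnorm z < r -> g z = 0) ->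
  forall z, D z -> g z = 0.
Proof.
move=> oD cD Dg D0 [r r0 gr].
pose Z := [set p | exists2 d : R, 0 < d & forall q, rnorm (q - p) < d -> g q = 0].
have oZ : open Z.
  rewrite openE => p [d d0 dP]; apply/nbhs_rnormP; exists (d / 2); first by rewrite divr_gt0.
  move=> q qp; exists (d / 2); first by rewrite divr_gt0.
  move=> w wq; apply: dP.
  by have := rnormD (w - q) (q - p); rewrite addrA subrK; lra.
have ZD : D `&` closure Z `<=` Z.
  move=> p [Dp Zp].
  have [d1 d10 d1P] := iffLR (nbhs_rnormP p D) (open_nbhs_nbhs (conj oD Dp)).
  have [K K0 [d2 d20 d2P]] := vderivable_lip (Dg p Dp).
  pose d := Num.min d1 d2; have d0 : 0 < d by rewrite lt_min d10.
  have [dd1 dd2] : d <= d1 /\ d <= d2 by split; rewrite ge_min lexx ?orbT.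
  pose s := d / 4; have s0 : 0 < s by rewrite divr_gt0.
  have [w [[u u0 uP] wp]] : Z `&` [set q | rnorm (q - p) < s / 4] !=set0.
    by apply: Zp; apply/nbhs_rnormP; exists (s / 4) => //; rewrite divr_gt0.
  rewrite /= in wp.
  exists (s / 4); first by rewrite divr_gt0.
  move=> q qp; have [->|qw] := eqVneq q w; first by apply: uP; rewrite subrr rnorm0.
  have near z : rnorm (z - w) <= 2 * s -> rnorm (z - p) < d.
    by move=> zw; have := rnormD (z - w) (w - p); rewrite addrA subrK /s in wp *; rewrite /s in zw; lra.
  have qws : rnorm (q - w) <= s / 2.
    by have := rnormD (q - p) (- (w - p)); rewrite rnormN opprB addrA subrK; lra.
  apply: rnorm_eq0; apply/eqP; rewrite eq_le rnorm_ge0 andbT.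
  pose M := rnorm (g p) + K * d.
  have M0 : 0 <= M by rewrite addr_ge0 ?rnorm_ge0// mulr_ge0// ltW.
  apply: (@pow_half_limit0 _ (8 * M)) => m.
  apply: le_trans (@vector_schwarz g w q s M m s0 _ _ _ qw qws) _.
  - by move=> z /near zp; apply: Dg; apply: d1P; exact: lt_le_trans dd1.
  - move=> z /near zp; rewrite -[g z](subrK (g p)) addrC.
    apply: le_trans (rnormD _ _) _; rewrite /M lerD//.
    apply: le_trans (d2P _ _) _; first exact: lt_le_trans dd2.
    by rewrite ler_pM2l// ltW.
  - move=> j _ e e0; exists u => // z /uP ->; rewrite rnorm0.
    by rewrite mulr_ge0 ?exprn_ge0 ?rnorm_ge0// ltW.
  - have qs0 : 0 <= rnorm (q - w) / s by rewrite divr_ge0 ?rnorm_ge0// ltW.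
    have qs1 : rnorm (q - w) / s <= 1 / 2 by rewrite ler_pdivrMr//; lra.
    by rewrite ler_wpM2l ?mulr_ge0// lerXn2r ?nnegrE//; lra.
have : D `&` Z = D.
  apply: cD.
  - by exists 0; split=> //; exists r => // q; rewrite subr0; exact: gr.
  - by exists Z.
  - exists (closure Z); first exact: closed_closure.
    apply/seteqP; split=> p [Dp Zp]; split=> //; first exact: subset_closure.
    exact: ZD.
move=> E z; rewrite -{1}E => -[_ [d d0 dP]]; apply: dP.
by rewrite subrr rnorm0.
Qed.

End VectorEstimates.

(** * Euclidean forms adapted to a matrix *)

Section HermitianForm.
Context {R : realType} {n : nat}.
Notation V := 'cV[R[i]]_n.
Implicit Types (S A N : 'M[R[i]]_n) (x y z : V).

(** The real part of the standard Hermitian product in the coordinates S x. *)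
Definition hform S x y : R := \sum_i complex.Re ((S *m x) i 0 * ((S *m y) i 0)^*%C).

Lemma hformDl S x y z : hform S (x + y) z = hform S x z + hform S y z.
Proof.
rewrite /hform -big_split; apply: eq_bigr => i _ /=.
by rewrite mulmxDr mxE mulrDl raddfD.
Qed.

Lemma hformC S x y : hform S x y = hform S y x.
Proof.
apply: eq_bigr => i _; case: ((S *m x) i 0) ((S *m y) i 0) => a b [c d].
by simpc => /=; ring.
Qed.

Lemma hformZl S (k : R) x y : hform S (k%:C *: x) y = k * hform S x y.
Proof.
rewrite /hform mulr_sumr; apply: eq_bigr => i _.
rewrite -scalemxAr mxE; case: ((S *m x) i 0) ((S *m y) i 0) => a b [c d].
by simpc => /=; ring.
Qed.

Lemma hformNl S x y : hform S (- x) y = - hform S x y.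
Proof.
rewrite /hform -sumrN; apply: eq_bigr => i _.
by rewrite mulmxN mxE mulNr raddfN.
Qed.

Lemma hformBl S x y z : hform S (x - y) z = hform S x z - hform S y z.
Proof. by rewrite hformDl hformNl. Qed.

Lemma hformDr S x y z : hform S x (y + z) = hform S x y + hform S x z.
Proof. by rewrite hformC hformDl ![hform S _ x]hformC. Qed.

Lemma hformZr S (k : R) x y : hform S x (k%:C *: y) = k * hform S x y.
Proof. by rewrite hformC hformZl hformC. Qed.

Lemma Re_mulJ (a : R[i]) : complex.Re (a * a^*%C) = rnorm a ^+ 2.
Proof.
case: a => u v; rewrite /rnorm normc_def /= sqr_sqrtr ?addr_ge0 ?sqr_ge0//.
by simpc => /=; rewrite !expr2.
Qed.

Lemma rnormJ (a : R[i]) : rnorm (a^*%C) = rnorm a.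
Proof. by rewrite /rnorm normcJ. Qed.

Lemma hformE S x : hform S x x = \sum_i rnorm ((S *m x) i 0) ^+ 2.
Proof. by apply: eq_bigr => i _; rewrite Re_mulJ. Qed.

Lemma hform_ge0 S x : 0 <= hform S x x.
Proof. by rewrite hformE sumr_ge0// => i _; rewrite sqr_ge0. Qed.

Lemma hform_bound S : exists2 C : R, 0 < C & forall x y, `|hform S x y| <= C * (rnorm x * rnorm y).
Proof.
have [K K0 SK] := mulmx_bounded S.
exists (n%:R * K ^+ 2 + 1); first by rewrite ltr_wpDl// mulr_ge0// sqr_ge0.
move=> x y; have xy0 : 0 <= rnorm x * rnorm y by rewrite mulr_ge0// rnorm_ge0.
apply: (@le_trans _ _ (n%:R * (K ^+ 2 * (rnorm x * rnorm y)))); last first.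
  by rewrite mulrA ler_wpM2r// lerDl.
rewrite mulr_natl -[X in _ *+ X]card_ord -sumr_const; apply: le_trans (ler_norm_sum _ _ _) _.
apply: ler_sum => i _; apply: le_trans (Re_le_rnorm _) _; rewrite rnormM rnormJ.
have -> : K ^+ 2 * (rnorm x * rnorm y) = (K * rnorm x) * (K * rnorm y) by ring.
by apply: ler_pM; rewrite ?rnorm_ge0//; apply: le_trans (rnorm_coord _ _) (SK _).
Qed.

Lemma hform0 S : hform S 0 0 = 0.
Proof. by rewrite /hform big1// => i _; rewrite mulmx0 mxE mul0r. Qed.

Lemma hform_expand S w z : hform S (z + w) (z + w) = hform S z z + 2 * hform S w z + hform S w w.
Proof.
by rewrite hformDl !hformDr [hform S z w]hformC; ring.
Qed.

Lemma hform_continuous S z : forall e : R, 0 < e -> exists2 d : R, 0 < d &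
  forall w, rnorm (w - z) < d -> `|hform S w w - hform S z z| < e.
Proof.
move=> e e0; have [C C0 CP] := hform_bound S.
have a0 := rnorm_ge0 z.
have K0 : 0 < C * (2 * rnorm z + 1) by rewrite mulr_gt0//; lra.
exists (Num.min 1 (e / (C * (2 * rnorm z + 1)))); first by rewrite lt_min ltr01 divr_gt0.
move=> y; rewrite lt_min ltr_pdivlMr// => /andP[h1 h2].
rewrite -[y](subrK z) [X in hform S X X]addrC hform_expand.
set w := y - z in h1 h2 *.
have -> : hform S z z + 2 * hform S w z + hform S w w - hform S z z =
   2 * hform S w z + hform S w w by ring.
apply: le_lt_trans (ler_normD _ _) _; rewrite normrM ger0_norm//.
have b1 := CP w z; have b2 := CP w w.
have w0 := rnorm_ge0 w.
have b3 : C * (rnorm w * rnorm w) <= C * rnorm w by rewrite ler_pM2l// ler_piMr// ltW.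
apply: le_lt_trans h2.
have -> : rnorm w * (C * (2 * rnorm z + 1)) = 2 * (C * (rnorm w * rnorm z)) + C * rnorm w by ring.
by clear -b1 b2 b3; lra.
Qed.

Lemma hform_coercive S : S \in unitmx -> exists2 c : R, 0 < c &
  forall x, rnorm x ^+ 2 <= c * hform S x x.
Proof.
move=> Su; have [K K0 SK] := mulmx_bounded (invmx S).
exists (K ^+ 2 + 1); first by rewrite ltr_wpDl// sqr_ge0.
move=> x; have h0 := hform_ge0 S x.
apply: (@le_trans _ _ (K ^+ 2 * hform S x x)); last by rewrite ler_wpM2r// lerDl.
have -> : rnorm x = rnorm (invmx S *m (S *m x)) by rewrite mulKmx.
apply: (@le_trans _ _ ((K * rnorm (S *m x)) ^+ 2)).
  by rewrite lerXn2r// ?nnegrE ?mulr_ge0 ?rnorm_ge0.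
rewrite exprMn ler_wpM2l ?sqr_ge0// -[leRHS]sqr_sqrtr//.
rewrite lerXn2r ?nnegrE ?rnorm_ge0 ?sqrtr_ge0//.
apply: rnorm_le_coord => [|i]; first exact: sqrtr_ge0.
rewrite -(@ger0_norm _ (rnorm _)) ?rnorm_ge0// -sqrtr_sqr ler_wsqrtr//.
rewrite hformE (bigD1 i)//= lerDl sumr_ge0// => j _; exact: sqr_ge0.
Qed.

(** In the coordinates S the matrix A becomes N: the diagonal of N contributes a
    weighted sum of squares and each off-diagonal entry at most e times a mean of
    two squares. *)
Lemma hform_diagonally_dominant S A N (a b e : R) : 0 <= e -> S *m A = N *m S ->
  (forall i, a <= complex.Re (N i i) <= b) ->
  (forall i j, i != j -> rnorm (N i j) <= e) ->
  forall x, (a - n%:R * e) * hform S x x <= hform S (A *m x) x <= (b + n%:R * e) * hform S x x.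
Proof.
move=> e0 SA Nd No x; pose y := S *m x.
pose Y i := rnorm (y i 0) ^+ 2.
pose off i := \sum_(j | j != i) complex.Re (N i j * y j 0 * (y i 0)^*%C).
have hE : hform S (A *m x) x = \sum_i (complex.Re (N i i) * Y i + off i).
  rewrite /hform; apply: eq_bigr => i _; rewrite mulmxA SA -mulmxA -/y mxE.
  rewrite mulr_suml raddf_sum (bigD1 i)//=; congr (_ + _).
  rewrite -mulrA /Y -Re_mulJ; case: (N i i) (y i 0) => u v [s t].
  by simpc => /=; ring.
have offE : `|\sum_i off i| <= n%:R * e * \sum_i Y i.
  apply: (@le_trans _ _ (\sum_i \sum_j e * ((Y i + Y j) / 2))).
    apply: le_trans (ler_norm_sum _ _ _) _; apply: ler_sum => i _.
    apply: le_trans (ler_norm_sum _ _ _) _.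
    rewrite [leRHS](bigID (fun j => j != i))/= ler_wpDr//.
      apply: sumr_ge0 => j _; rewrite mulr_ge0// divr_ge0// addr_ge0// sqr_ge0//.
    apply: ler_sum => j ji; apply: le_trans (Re_le_rnorm _) _.
    rewrite !rnormM rnormJ -mulrA ler_pM ?rnorm_ge0 ?mulr_ge0 ?rnorm_ge0//.
      by apply: No; rewrite eq_sym.
    rewrite /Y; have := sqr_ge0 (rnorm (y i 0) - rnorm (y j 0)); lra.
  have -> : \sum_i \sum_j e * ((Y i + Y j) / 2) = n%:R * e * \sum_i Y i.
    under eq_bigr do rewrite -mulr_sumr -mulr_suml big_split /= sumr_const card_ord.
    rewrite -mulr_sumr -mulr_suml big_split /= sumr_const card_ord sumrMnl.
    by rewrite -mulr2n -[_ *+ 2]mulr_natr mulfK// -mulr_natl; ring.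
  by [].
have Y0 i : 0 <= Y i by exact: sqr_ge0.
have dE : a * \sum_i Y i <= \sum_i complex.Re (N i i) * Y i <= b * \sum_i Y i.
  rewrite !mulr_sumr; apply/andP; split; apply: ler_sum => i _; have /andP[? ?] := Nd i.
    by rewrite ler_wpM2r.
  by rewrite ler_wpM2r.
rewrite hE hformE -/y -/(Y _) big_split /=.
move: dE offE; rewrite ler_norml => /andP[d1 d2] /andP[u1 u2].
rewrite mulrBl mulrDl; apply/andP; split.
  by apply: lerD => //; rewrite mulNr in u1 *.
exact: lerD.
Qed.

End HermitianForm.

Section Lyapunov.
Context {R : realType} {n : nat}.

(** Since x / 0 = 0, the bound on the quotient is informative only once the infimum
    is known to be positive, which it is because it is attained. *)
Lemma distortion_gap (A : 'M[R[i]]_n) (lam : 'I_n -> R[i]) : (0 < n)%N ->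
  (forall a, eigenvalue A a <-> exists i, a = lam i) ->
  (forall a, spectrum A a -> complex.Re a < 0) -> spectrum_distortion A < 2 ->
  exists a b : R, [/\ 0 < a, b < 2 * a & forall i, - b <= complex.Re (lam i) <= - a].
Proof.
move=> n0 eA ReA dA.
pose E := [set `|complex.Re a| | a in spectrum A].
pose i0 := Ordinal n0.
pose m i := - complex.Re (lam i).
have m0 i : 0 < m i by rewrite oppr_gt0; apply: ReA; apply/eA; exists i.
have Em : E = range m.
  apply/seteqP; split => t.
    by move=> [a /eA[i ->] <-]; exists i => //; rewrite ltr0_norm// -oppr_gt0; exact: m0.
  move=> [i _ <-]; exists (lam i); first by apply/eA; exists i.
  by rewrite ltr0_norm// -oppr_gt0; exact: m0.
have ne : E !=set0 by rewrite Em; exists (m i0), i0.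
have [i1 _ m1] := arg_minP (P := predT) (i0 := i0) m isT.
have [i2 _ m2] := arg_maxP (P := predT) (i0 := i0) m isT.
have lb : lbound E (m i1) by rewrite Em => _ [i _ <-]; exact: m1.
have ub : ubound E (m i2) by rewrite Em => _ [i _ <-]; exact: m2.
have inf0 : 0 < inf E by apply: lt_le_trans (m0 i1) _; exact: lb_le_inf.
exists (inf E), (sup E); split=> //.
  by move: dA; rewrite /spectrum_distortion -/E ltr_pdivrMr.
have mE i : E (m i) by rewrite Em; exists i.
move=> i; have h1 : inf E <= m i by apply: ge_inf => //; exists (m i1).
have h2 : m i <= sup E by apply: ub_le_sup => //; exists (m i2).
by rewrite /m in h1 h2; apply/andP; split; lra.
Qed.

(** Schur's theorem makes A lower triangular in a unitary basis; conjugation by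
    diag(1, d, d^2, ...) multiplies the (i, j) entry, j < i, by d^(i-j) and so
    makes the off-diagonal part negligible.  The slack g is a fraction of
    2 a - b, so that the gap b < 2 a survives. *)
Lemma lyapunov_form (A : 'M[R[i]]_n) : (0 < n)%N ->
  (forall a, spectrum A a -> complex.Re a < 0) -> spectrum_distortion A < 2 ->
  exists (S : 'M[R[i]]_n) (a b : R), [/\ S \in unitmx, 0 < a, b < 2 * a &
    forall x, - b * hform S x x <= hform S (A *m x) x <= - a * hform S x x].
Proof.
move=> n0 ReA dA.
have [P Pun PT] := Schur A n0; have Pu := unitarymx_unit Pun.
have [T Ttrig TP] : exists2 T : 'M[R[i]]_n, is_trig_mx T & T *m P = P *m A.
  by exists (conjmx P A) => //; rewrite conjumx// mulmxKV.
have eA c : eigenvalue A c <-> exists i, c = T i i.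
  have -> : eigenvalue A c = eigenvalue T c.
    apply/eigenvalueP/eigenvalueP => -[v vc v0].
      exists (v *m invmx P).
        by rewrite -[T](mulmxK Pu) TP !mulmxA mulmxKV// vc scalemxAl.
      by apply: contra v0 => /eqP vP; rewrite -[v](mulmxKV Pu) vP mul0mx.
    exists (v *m P); first by rewrite -mulmxA -TP mulmxA vc scalemxAl.
    by apply: contra v0 => /eqP vP; rewrite -[v](mulmxK Pu) vP mul0mx.
  rewrite eigenvalue_root_char char_poly_trig// /root horner_prod; split.
    move=> /prodf_eq0[i _]; rewrite !hornerE subr_eq0 => /eqP ->; by exists i.
  move=> [i ->]; apply/prodf_eq0; exists i => //; by rewrite !hornerE subrr.
have [a [b [a0 ba ab]]] := distortion_gap n0 eA ReA dA.
(* The final rates a - g and b + g still satisfy b + g < 2 (a - g). *)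
pose g := (2 * a - b) / 4; have g0 : 0 < g by rewrite divr_gt0// subr_gt0.
have aleb : a <= b by have /andP[h1 h2] := ab (Ordinal n0); lra.
pose K := \sum_i \sum_j rnorm (T i j).
have TK i j : rnorm (T i j) <= K.
  rewrite /K (bigD1 i)//= (bigD1 j)//= -addrA lerDl addr_ge0//.
    by apply: sumr_ge0 => k _; exact: rnorm_ge0.
  by apply: sumr_ge0 => k _; apply: sumr_ge0 => l _; exact: rnorm_ge0.
have K0 : 0 <= K by apply: le_trans (TK (Ordinal n0) (Ordinal n0)); exact: rnorm_ge0.
have nR0 : 0 < n%:R :> R by rewrite ltr0n.
pose d : R := Num.min 1 (g / (n%:R * (K + 1))).
have d0 : 0 < d by rewrite lt_min ltr01 divr_gt0// mulr_gt0// ltr_wpDl.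
have d1 : d <= 1 by rewrite ge_min lexx.
have dg : n%:R * (d * K) <= g.
  have : d <= g / (n%:R * (K + 1)) by rewrite ge_min lexx orbT.
  rewrite ler_pdivlMr; last by rewrite mulr_gt0// ltr_wpDl.
  apply: le_trans; rewrite mulrCA ler_wpM2l ?(ltW d0)// ler_wpM2l ?(ltW nR0)// lerDl//.
have dC k : ((d ^+ k)%:C : R[i]) != 0.
  by rewrite -[0]/(0%:C) (inj_eq (@complexI _)) expf_neq0// gt_eqF.
pose Dm := diag_mx (\row_(i < n) ((d ^+ i)%:C : R[i])).
pose N : 'M[R[i]]_n := \matrix_(i, j) ((d ^+ i)%:C * T i j / (d ^+ j)%:C).
have NE i j : N i j = (d ^+ i)%:C * T i j / (d ^+ j)%:C by rewrite [LHS]mxE.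
exists (Dm *m P), (a - g), (b + g).
have SA : Dm *m P *m A = N *m (Dm *m P).
  rewrite -mulmxA -TP !mulmxA; congr (_ *m P); apply/matrixP => i j.
  rewrite mul_diag_mx mul_mx_diag [LHS]mxE [RHS]mxE NE ![(\row__ _) _ _]mxE mulfVK//.
split.
- rewrite unitmx_mul Pu andbT unitmxE det_diag unitfE.
  by apply/prodf_neq0 => i _; rewrite mxE.
- by rewrite /g; lra.
- by rewrite /g; lra.
have dK0 : 0 <= d * K by rewrite mulr_ge0// ltW.
have Nd i : - b <= complex.Re (N i i) <= - a.
  by rewrite mxE mulrAC mulfV ?mul1r; [exact: ab|exact: dC].
have No i j : i != j -> rnorm (N i j) <= d * K.
  move=> ij; rewrite NE; have [lij|] := ltnP i j.
    by move/is_trig_mxP: Ttrig => -> //; rewrite mulr0 mul0r rnorm0.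
  rewrite leq_eqVlt => /orP[/eqP E|lji]; first by case/eqP: ij; apply/val_inj.
  rewrite !rnormM rnormV !rnormR !ger0_norm ?exprn_ge0 ?(ltW d0)// mulrAC.
  apply: ler_pM => //; last first.
  - have -> : d ^+ i / d ^+ j = d ^+ (i - j) by rewrite expfB ?gt_eqF.
    by rewrite -(subnSK lji) exprS ler_piMr ?(ltW d0)// exprn_ile1// ltW.
  - exact: rnorm_ge0.
  - by rewrite divr_ge0 ?exprn_ge0 ?(ltW d0).
move=> x; have /andP[h1 h2] := hform_diagonally_dominant dK0 SA Nd No x.
have h0 := hform_ge0 (Dm *m P) x.
apply/andP; split.
  apply: le_trans h1; rewrite ler_wpM2r//; lra.
by apply: le_trans h2 _; rewrite ler_wpM2r//; lra.
Qed.

End Lyapunov.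

(** * Differential inequalities for right derivatives *)

Section Dini.
Context {R : realType}.
Implicit Types (u v : R -> R) (c k t : R).

Definition cont_nonneg u := forall t, 0 <= t -> forall e : R, 0 < e ->
  exists2 d : R, 0 < d & forall s, 0 <= s -> `|s - t| < d -> `|u s - u t| < e.

(** The inequality is only required below the level c, which is how a trajectory is
    prevented from leaving a sublevel set on which nothing is known outside.  If
    v T exceeded v 0, consider the last time up to which v s <= v 0 + e s. *)
Lemma dini_nonincreasing v c : cont_nonneg v -> v 0 < c ->
  (forall t, 0 <= t -> v t < c -> forall e : R, 0 < e -> exists2 d : R, 0 < d &
    forall h, 0 < h -> h < d -> v (t + h) <= v t + e * h) ->
  forall t, 0 <= t -> v t <= v 0.
Proof.
move=> vC v0c vD T T0; rewrite leNgt; apply/negP => vT.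
have T1 : 0 < 2 * (T + 1) by lra.
(* This slope keeps v 0 + e T below both c and v T. *)
pose e := Num.min (c - v 0) (v T - v 0) / (2 * (T + 1)).
have e0 : 0 < e by rewrite divr_gt0// lt_min !subr_gt0 v0c.
have eT : e * T < Num.min (c - v 0) (v T - v 0).
  have -> : Num.min (c - v 0) (v T - v 0) = e * (2 * (T + 1)) by rewrite /e mulfVK// gt_eqF.
  by rewrite ltr_pM2l//; lra.
move: eT; rewrite lt_min => /andP[eTc eTv].
pose S := [set t | 0 <= t <= T /\ forall s, 0 <= s <= t -> v s <= v 0 + e * s].
have S0 : S 0.
  split; first by rewrite lexx.
  by move=> s /andP[s1 s2]; have -> : s = 0; [lra|rewrite mulr0 addr0].
have hS : has_ubound S by exists T => t [/andP[]].
have tau0 : 0 <= sup S by exact: ub_le_sup.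
have tauT : sup S <= T by apply: ge_sup; [exists 0|move=> t [/andP[]]].
set tau := sup S in tau0 tauT.
have below s : 0 <= s -> s < tau -> v s <= v 0 + e * s.
  move=> s0 st; have [t [_ tS] lt_st] := sup_gt (ex_intro _ _ S0) st.
  by apply: tS; rewrite s0 ltW.
have at_tau : v tau <= v 0 + e * tau.
  rewrite leNgt; apply/negP => vt.
  have g0 : 0 < v tau - (v 0 + e * tau) by rewrite subr_gt0.
  have [d d0 dP] := vC tau tau0 _ g0.
  have tau_gt0 : 0 < tau.
    by rewrite lt_neqAle tau0 andbT; apply/eqP => E; move: vt; rewrite -E mulr0 addr0 ltxx.
  pose s := Num.max 0 (tau - d / 2).
  have s0 : 0 <= s by rewrite le_max lexx.
  have st : s < tau by rewrite gt_max tau_gt0/=; lra.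
  have sd : tau - d / 2 <= s by rewrite le_max lexx orbT.
  have sd' : `|s - tau| < d by rewrite ltr_norml; apply/andP; split; lra.
  have := dP s s0 sd'; rewrite ltr_norml => /andP[h3 h4].
  have h1 := below s s0 st.
  have : e * s <= e * tau by rewrite ler_pM2l// ltW.
  lra.
have tau_c : v tau < c.
  have : e * tau <= e * T by rewrite ler_pM2l.
  lra.
have [tT|tT] := ltP tau T; last first.
  have E : tau = T by lra.
  by move: at_tau; rewrite E; lra.
have [d d0 dP] := vD tau tau0 tau_c e e0.
pose h := Num.min (d / 2) (T - tau).
have h0 : 0 < h by rewrite lt_min divr_gt0//= subr_gt0.
have [hd hT] : h <= d / 2 /\ h <= T - tau by split; rewrite ge_min lexx ?orbT.
have : S (tau + h).
  split; first by apply/andP; split; lra.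
  move=> s /andP[s0 sh]; have [st|ts] := ltP s tau; first exact: below.
  have [->//|ts'] := eqVneq s tau.
  have {}ts : 0 < s - tau by rewrite subr_gt0 lt_neqAle eq_sym ts'.
  have := dP _ ts; have -> : tau + (s - tau) = s by ring.
  move=> /(_ _) H; have /H : s - tau < d by lra.
  by rewrite mulrBr; lra.
by move=> /(ub_le_sup hS); rewrite -/tau; lra.
Qed.

Lemma cont_nonnegM u v : cont_nonneg u -> cont_nonneg v -> cont_nonneg (fun t => u t * v t).
Proof.
move=> uC vC t t0 e e0.
set a := `|u t|; set b := `|v t|.
have [a0 b0] : 0 <= a /\ 0 <= b by rewrite !normr_ge0.
have K0 : 0 < 2 * (a + b + 1) by lra.
have e2 : 0 < Num.min 1 (e / (2 * (a + b + 1))) by rewrite lt_min ltr01 /= divr_gt0.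
have [d d0 dP] := uC t t0 _ e2; have [d' d'0 d'P] := vC t t0 _ e2.
exists (Num.min d d'); first by rewrite lt_min d0.
move=> s s0; rewrite lt_min => /andP[/(dP _ s0) hu /(d'P _ s0) hv].
move: hu hv; rewrite !lt_min => /andP[u1 ue] /andP[_ ve].
have -> : u s * v s - u t * v t = (u s - u t) * (v s - v t) + (u s - u t) * v t + u t * (v s - v t) by ring.
apply: le_lt_trans (ler_normD _ _) _; apply: le_lt_trans (lerD (ler_normD _ _) (lexx _)) _.
rewrite !normrM -/a -/b.
rewrite !ltr_pdivlMr// in ue ve.
set x := `|u s - u t| in u1 ue *; set y := `|v s - v t| in ve *.
have x0 : 0 <= x by exact: normr_ge0.
have y0 : 0 <= y by exact: normr_ge0.
have xy : x * y <= y by rewrite ler_piMl// ltW.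
clear -a0 b0 x0 y0 xy ue ve e0; nra.
Qed.

Lemma cont_nonneg_exp k : cont_nonneg (fun t => expR (k * t)).
Proof.
move=> t _ e e0.
have : (fun s => expR (k * s)) @ t --> expR (k * t).
  by apply: continuous_comp; [exact: mulrl_continuous|exact: continuous_expR].
move=> /cvgrPdist_lt/(_ e e0)/nbhs_ballP[d /= d0 dP].
by exists d => // s _ st; rewrite distrC; apply: dP; rewrite /ball /= distrC.
Qed.

Lemma expR_small_le2 (x : R) : x <= 1 / 2 -> expR x <= 2.
Proof.
move=> x2; have := expR_ge1Dx (- x); rewrite expRN => h.
have p := expR_gt0 x.
have h2 : 1 / 2 <= (expR x)^-1 by lra.
have := ler_pM2r p (1 / 2) (expR x)^-1; rewrite h2 mulVf ?gt_eqF//; lra.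
Qed.

(** The function u exp(-k t) has nonpositive right Dini derivative.  Since u may
    have either sign, both 1 - (k h)^2 <= exp(-k h) (1 + k h) and the upper bound 1
    are needed. *)
Lemma gronwall u k : cont_nonneg u ->
  (forall t, 0 <= t -> forall e : R, 0 < e -> exists2 d : R, 0 < d &
    forall h, 0 < h -> h < d -> u (t + h) <= u t + h * (k * u t + e)) ->
  forall t, 0 <= t -> u t <= u 0 * expR (k * t).
Proof.
move=> uC uD t t0; pose v s := u s * expR (- k * s).
have vt : v t <= v 0.
  apply: (@dini_nonincreasing v (v 0 + 1)) => //; last 1 first.
  - move=> s s0 _ e e0; set E := expR (- k * s).
    have E0 : 0 < E by exact: expR_gt0.
    have eE : 0 < e / (4 * E) by rewrite divr_gt0// mulr_gt0.
    have [d d0 dP] := uD s s0 _ eE.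
    set K := `|u s| * k ^+ 2.
    have K0 : 0 <= K by rewrite mulr_ge0 ?normr_ge0 ?sqr_ge0.
    have k0 : 0 <= `|k| by [].
    have k2 : 0 < 2 * (`|k| + 1) by lra.
    have E2 : 0 < 2 * E * (K + 1) by rewrite !mulr_gt0//; lra.
    exists (Num.min d (Num.min (1 / (2 * (`|k| + 1))) (e / (2 * E * (K + 1))))).
      by rewrite !lt_min d0 !divr_gt0.
    move=> h h0; rewrite !lt_min => /andP[hd /andP[]].
    rewrite !ltr_pdivlMr//.
    move=> hk hK; have uh := dP h h0 hd.
    have kh : - k * h <= 1 / 2.
      have : - k <= `|k| by rewrite -normrN ler_norm.
      by move=> kk; have : - k * h <= `|k| * h; [rewrite ler_pM2r|lra].
    have kh' : k * h <= 1 / 2.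
      have : k <= `|k| by rewrite ler_norm.
      by move=> kk; have : k * h <= `|k| * h; [rewrite ler_pM2r|lra].
    have e2 := expR_small_le2 kh.
    have ege := expR_ge1Dx (- k * h); have ege' := expR_ge1Dx (k * h).
    have p := expR_gt0 (- k * h).
    rewrite /v mulrDr expRD -/E.
    set X := expR (- k * h) in e2 ege p *.
    have XV : X * expR (k * h) = 1 by rewrite /X -expRD mulNr addNr expR0.
    have X1 : X * (1 + k * h) <= 1 by rewrite -[leRHS]XV ler_pM2l.
    have X2 : 1 - (k * h) ^+ 2 <= X * (1 + k * h).
      have -> : 1 - (k * h) ^+ 2 = (1 + - k * h) * (1 + k * h) by ring.
      by rewrite ler_wpM2r//; lra.
    have A : X * (1 + k * h) * u s <= u s + K * h ^+ 2.
      have -> : X * (1 + k * h) * u s = u s + (X * (1 + k * h) - 1) * u s by ring.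
      rewrite lerD2l; apply: le_trans (ler_norm _) _; rewrite normrM.
      have -> : K * h ^+ 2 = (k * h) ^+ 2 * `|u s| by rewrite /K; ring.
      rewrite ler_wpM2r// ler_norml; apply/andP; split; first by lra.
      by have := sqr_ge0 (k * h); lra.
    have B : X * u (s + h) <= u s + K * h ^+ 2 + 2 * (h * (e / (4 * E))).
      apply: (@le_trans _ _ (X * (u s + h * (k * u s + e / (4 * E))))); first by rewrite ler_pM2l.
      have -> : X * (u s + h * (k * u s + e / (4 * E))) = X * (1 + k * h) * u s + X * (h * (e / (4 * E))) by ring.
      by apply: lerD => //; rewrite ler_wpM2r// mulr_ge0 ?(ltW h0)// ltW.
    have C : u (s + h) * (E * X) <= E * (u s + K * h ^+ 2 + 2 * (h * (e / (4 * E)))).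
      have -> : u (s + h) * (E * X) = E * (X * u (s + h)) by ring.
      by rewrite ler_pM2l.
    apply: le_trans C _.
    have -> : E * (u s + K * h ^+ 2 + 2 * (h * (e / (4 * E)))) =
      u s * E + (e * h / 2 + (h * (2 * E * K)) * h / 2) by field; rewrite gt_eqF.
    have D : h * (2 * E * K) <= e.
      have : h * (2 * E * K) <= h * (2 * E * (K + 1)).
        rewrite ler_pM2l// ler_pM2l; last by rewrite mulr_gt0.
        lra.
      lra.
    have D2 : (h * (2 * E * K)) * h <= e * h by rewrite ler_pM2r.
    lra.
  - by apply: cont_nonnegM => //; exact: cont_nonneg_exp.
  - by rewrite ltrDl.
move: vt; rewrite /v mulr0 expR0 mulr1 mulNr expRN => vt.
have p := expR_gt0 (k * t).
by rewrite -ler_pdivrMr.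
Qed.

Lemma exp_rate_le0 (X K k : R) : 0 < k -> (forall t, 0 <= t -> X <= K * expR (- k * t)) -> X <= 0.
Proof.
move=> k0 H; rewrite leNgt; apply/negP => X0.
have K0 : 0 < K by have := H 0 (lexx _); rewrite mulr0 expR0 mulr1; exact: lt_le_trans.
pose t := K / (X * k); have Xk : 0 < X * k by rewrite mulr_gt0.
have t0 : 0 < t by rewrite divr_gt0.
have := H t (ltW t0); have := expR_ge1Dx (k * t); rewrite mulNr expRN => h1.
have p := expR_gt0 (k * t).
rewrite ler_pdivlMr// leNgt => /negP; apply.
have -> : K = X * (k * t) by rewrite /t; field; rewrite !gt_eqF.
by rewrite ltr_pM2l//; lra.
Qed.

End Dini.

(** * Continuity points of right-continuous trajectories *)

Section RightContinuous.
Context {R : realType} {V : normedModType R[i]}.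
Implicit Types (x : R -> V).

(** Right-continuity at the midpoint of an interval gives a subinterval, strictly
    inside, with small oscillation; nesting such intervals leaves a point interior
    to all of them. *)
Lemma right_continuous_has_continuity_point x :
  (forall t, 0 <= t -> forall e : R, 0 < e -> exists2 d : R, 0 < d &
    forall h, 0 < h -> h < d -> rnorm (x (t + h) - x t) < e) ->
  forall T : R, 0 < T -> exists2 tau : R, 0 < tau < T &
    forall e : R, 0 < e -> exists2 d : R, 0 < d & forall s, `|s - tau| < d -> rnorm (x s - x tau) < e.
Proof.
move=> xR T T0.
pose good (kr : nat * (R * R)) (r' : R * R) := let: (k, (a, b)) := kr in let: (a', b') := r' in
  [/\ a < a', a' < b', b' < b & forall s s', a' <= s <= b' -> a' <= s' <= b' ->
    rnorm (x s - x s') < k.+1%:R^-1].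
have /choice[f fP] : forall kr, exists r', 0 <= kr.2.1 -> kr.2.1 < kr.2.2 -> good kr r'.
  move=> [k [a b]] /=; have [ab|nab] := pselect (0 <= a /\ a < b); last first.
    by exists (a, b) => a0 ab; case: nab.
  case: ab => a0 ab; pose t := (a + b) / 2.
  have [ta tb] : a < t /\ t < b by rewrite /t; split; lra.
  have e0 : 0 < k.+1%:R^-1 / 2 :> R by rewrite divr_gt0 ?invr_gt0.
  have [d d0 dP] := xR t (le_trans a0 (ltW ta)) _ e0.
  pose m := Num.min d (b - t) / 2.
  have m0 : 0 < m by rewrite divr_gt0// lt_min d0 subr_gt0.
  have [md mb] : m < d /\ m < b - t.
    have : Num.min d (b - t) <= d /\ Num.min d (b - t) <= b - t by split; rewrite ge_min lexx ?orbT.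
    by rewrite /m in m0 *; move=> []; lra.
  exists (t, t + m) => _ _; split=> //; try by lra.
  have near s : t <= s <= t + m -> rnorm (x s - x t) < k.+1%:R^-1 / 2.
    move=> /andP[ts sm]; have [->|st] := eqVneq s t; first by rewrite subrr rnorm0.
    have -> : s = t + (s - t) by ring.
    apply: dP; last by lra.
    by rewrite subr_gt0 lt_neqAle eq_sym st.
  move=> s s' /near h /near h'.
  have -> : x s - x s' = (x s - x t) - (x s' - x t) by rewrite opprB addrA subrK.
  by apply: le_lt_trans (rnormD _ _) _; rewrite rnormN [k.+1%:R^-1]splitr ltrD.
pose r := fix r k := if k is k'.+1 then f (k', r k') else (0, T).
have r_ok k : 0 <= (r k).1 /\ (r k).1 < (r k).2.
  elim: k => [//|k [IH1 IH2]] /=.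
  have := fP (k, r k) IH1 IH2; rewrite /good; case: (r k) IH1 IH2 => a b /= a0 ab.
  by case: (f _) => a' b' [? ? ? _] /=; split=> //; lra.
have rP k : good (k, r k) (r k.+1) by have [h1 h2] := r_ok k; exact: fP.
have rP' k : [/\ (r k).1 < (r k.+1).1, (r k.+1).1 < (r k.+1).2, (r k.+1).2 < (r k).2 &
    forall s s', (r k.+1).1 <= s <= (r k.+1).2 -> (r k.+1).1 <= s' <= (r k.+1).2 ->
    rnorm (x s - x s') < k.+1%:R^-1].
  by have := rP k; case: (r k) (r k.+1) => a b [a' b'].
have [tau tauP] : exists tau, forall k, (r k).1 <= tau <= (r k).2.
  by apply: nested_intervals => k; [case: (rP' k) => /ltW|case: (rP' k) => _ _ /ltW|have [_ /ltW] := r_ok k].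
have tauS k : (r k).1 < tau < (r k).2.
  have [h1 _ h2 _] := rP' k; have /andP[h3 h4] := tauP k.+1.
  by rewrite (lt_le_trans h1 h3) (le_lt_trans h4 h2).
exists tau; first exact: (tauS 0%N).
move=> e e0.
have [k kP] : exists k : nat, k.+1%:R^-1 < e.
  exists (Num.bound e^-1); rewrite invf_plt ?posrE//.
  apply: lt_trans (archi_boundP _) _; first by rewrite invr_ge0 ltW.
  by rewrite ltr_nat.
have [_ _ _ osc] := rP' k; have /andP[t1 t2] := tauS k.+1.
exists (Num.min (tau - (r k.+1).1) ((r k.+1).2 - tau)); first by rewrite lt_min !subr_gt0 t1.
move=> s; rewrite lt_min !ltr_norml => /andP[/andP[s1 s2] /andP[s3 s4]].
apply: lt_trans kP; apply: osc; last by rewrite !ltW.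
by apply/andP; split; lra.
Qed.

End RightContinuous.

(** * Trajectories of semigroups *)

Section Trajectories.
Context {R : realType} {n : nat}.
Notation V := 'cV[R[i]]_n.
Implicit Types (x y : R -> V) (w z : V) (S A : 'M[R[i]]_n) (t h : R).

Definition traj_continuous x := forall t, 0 <= t -> forall e : R, 0 < e ->
  exists2 d : R, 0 < d & forall s, 0 <= s -> `|s - t| < d -> rnorm (x s - x t) < e.

Definition right_derivative x w t := forall e : R, 0 < e ->
  exists2 d : R, 0 < d & forall h, 0 < h -> h < d -> rnorm (x (t + h) - x t - h%:C *: w) <= e * h.

Lemma traj_continuousB x y : traj_continuous x -> traj_continuous y ->
  traj_continuous (fun t => x t - y t).
Proof.
move=> xC yC t t0 e e0; have e2 : 0 < e / 2 by rewrite divr_gt0.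
have [d d0 dP] := xC t t0 _ e2; have [d' d'0 d'P] := yC t t0 _ e2.
exists (Num.min d d'); first by rewrite lt_min d0.
move=> s s0; rewrite lt_min => /andP[/(dP _ s0) h1 /(d'P _ s0) h2].
have -> : x s - y s - (x t - y t) = (x s - x t) - (y s - y t).
  by apply/matrixP => i j; rewrite !mxE; ring.
by apply: le_lt_trans (rnormD _ _) _; rewrite rnormN [e]splitr ltrD.
Qed.

Lemma right_derivativeB x y w z t : right_derivative x w t -> right_derivative y z t ->
  right_derivative (fun t => x t - y t) (w - z) t.
Proof.
move=> xD yD e e0; have e2 : 0 < e / 2 by rewrite divr_gt0.
have [d d0 dP] := xD _ e2; have [d' d'0 d'P] := yD _ e2.
exists (Num.min d d'); first by rewrite lt_min d0.
move=> h h0; rewrite lt_min => /andP[/(dP _ h0) h1 /(d'P _ h0) h2].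
have -> : x (t + h) - y (t + h) - (x t - y t) - h%:C *: (w - z) =
    (x (t + h) - x t - h%:C *: w) - (y (t + h) - y t - h%:C *: z).
  by apply/matrixP => i j; rewrite !mxE; ring.
apply: le_trans (rnormD _ _) _; rewrite rnormN [e]splitr mulrDl; exact: lerD.
Qed.

Lemma hform_traj_continuous S x : traj_continuous x -> cont_nonneg (fun t => hform S (x t) (x t)).
Proof.
move=> xC t t0 e e0; have [d d0 dP] := hform_continuous S (x t) e0.
have [d' d'0 d'P] := xC t t0 _ d0.
by exists d' => // s s0 /(d'P _ s0) /dP.
Qed.

Lemma hform_right_derivative S x w t : right_derivative x w t -> forall e : R, 0 < e ->
  exists2 d : R, 0 < d & forall h, 0 < h -> h < d ->
  `|hform S (x (t + h)) (x (t + h)) - hform S (x t) (x t) - h * (2 * hform S w (x t))| <= e * h.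
Proof.
move=> xD e e0; have [C C0 CP] := hform_bound S.
set a := rnorm (x t); set b := rnorm w.
have a0 : 0 <= a by exact: rnorm_ge0.
have b0 : 0 <= b by exact: rnorm_ge0.
have K1 : 0 < 4 * (C * a + 1) by rewrite mulr_gt0// ltr_wpDl// mulr_ge0// ltW.
have K2 : 0 < 2 * (C * (b + 1) ^+ 2) by rewrite mulr_gt0// mulr_gt0// exprn_gt0// ltr_wpDl.
have e1 : 0 < Num.min 1 (e / (4 * (C * a + 1))) by rewrite lt_min ltr01 divr_gt0.
have [d d0 dP] := xD _ e1.
exists (Num.min d (e / (2 * (C * (b + 1) ^+ 2)))); first by rewrite lt_min d0 divr_gt0.
move=> h h0; rewrite lt_min ltr_pdivlMr// => /andP[/(dP _ h0)].
set r := x (t + h) - x t - h%:C *: w; set m := Num.min _ _ => rm hK.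
have [m1 m2] : m <= 1 /\ m <= e / (4 * (C * a + 1)) by split; rewrite /m ge_min lexx ?orbT.
have m0 : 0 < m by [].
have -> : x (t + h) = x t + (h%:C *: w + r) by apply/matrixP => i j; rewrite /r !mxE; ring.
rewrite hform_expand hformDl hformZl.
set dl := h%:C *: w + r.
have -> : hform S (x t) (x t) + 2 * (h * hform S w (x t) + hform S r (x t)) + hform S dl dl
  - hform S (x t) (x t) - h * (2 * hform S w (x t)) = 2 * hform S r (x t) + hform S dl dl by ring.
apply: le_trans (ler_normD _ _) _; rewrite normrM ger0_norm//.
have dlb : rnorm dl <= h * (b + 1).
  apply: le_trans (rnormD _ _) _; rewrite rnormZ rnormR gtr0_norm// -/b mulrDr mulr1 lerD2l.
  by apply: le_trans rm _; rewrite ler_piMl// ltW.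
have B2 : `|hform S dl dl| <= e * h / 2.
  apply: le_trans (CP _ _) _.
  apply: (@le_trans _ _ (C * (h * (b + 1) * (h * (b + 1))))).
    by rewrite ler_pM2l// ler_pM// rnorm_ge0.
  have -> : C * (h * (b + 1) * (h * (b + 1))) = (h * (2 * (C * (b + 1) ^+ 2))) * h / 2 by field.
  by rewrite ler_pM2r ?invr_gt0// ler_pM2r// ltW.
have B1 : 2 * `|hform S r (x t)| <= e * h / 2.
  have : `|hform S r (x t)| <= C * (m * h * a).
    by apply: le_trans (CP _ _) _; rewrite ler_pM2l// -/a ler_wpM2r.
  have : m * (4 * (C * a + 1)) <= e by rewrite -ler_pdivlMr.
  have mh : 0 < m * h by rewrite mulr_gt0.
  move=> k1 k2.
  have : m * (4 * (C * a + 1)) * h <= e * h by rewrite ler_pM2r.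
  have -> : m * (4 * (C * a + 1)) * h = 4 * (C * (m * h * a)) + 4 * (m * h) by ring.
  by clear -k2 mh => k3; lra.
by clear -B1 B2; lra.
Qed.

Lemma close_le (a b c c' m : R) : `|a - b - c| <= m -> c <= c' -> a <= b + (c' + m).
Proof. by rewrite ler_norml => /andP[_ h1] h2; lra. Qed.

Lemma close_ge (a b c c' m : R) : `|a - b - c| <= m -> c' <= c -> - a <= - b + (- c' + m).
Proof. by rewrite ler_norml => /andP[h1 _] h2; lra. Qed.

Section Energy.
Variables (S : 'M[R[i]]_n) (x w : R -> V).
Hypothesis xC : traj_continuous x.
Hypothesis xD : forall t, 0 <= t -> right_derivative x (w t) t.
Let q t := hform S (x t) (x t).

Lemma energy_trapped (c : R) : q 0 < c ->
  (forall t, 0 <= t -> q t < c -> hform S (w t) (x t) <= 0) ->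
  forall t, 0 <= t -> q t <= q 0.
Proof.
move=> q0 H; apply: (dini_nonincreasing (c := c)) => //; first exact: hform_traj_continuous.
move=> t t0 qt e e0; have [d d0 dP] := hform_right_derivative S (xD t0) e0.
exists d => // h h0 hd; rewrite -[e * h]add0r; apply: close_le (dP h h0 hd) _.
by rewrite pmulr_rle0// pmulr_rle0//; exact: H.
Qed.

Lemma energy_upper (k : R) :
  (forall t, 0 <= t -> hform S (w t) (x t) <= k * q t) ->
  forall t, 0 <= t -> q t <= q 0 * expR (2 * k * t).
Proof.
move=> H; apply: gronwall; first exact: hform_traj_continuous.
move=> t t0 e e0; have [d d0 dP] := hform_right_derivative S (xD t0) e0.
exists d => // h h0 hd.
have -> : h * (2 * k * q t + e) = h * (2 * (k * q t)) + e * h by ring.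
by apply: close_le (dP h h0 hd) _; rewrite ler_pM2l// ler_pM2l//; exact: H.
Qed.

Lemma energy_lower (k : R) :
  (forall t, 0 <= t -> k * q t <= hform S (w t) (x t)) ->
  forall t, 0 <= t -> q 0 * expR (2 * k * t) <= q t.
Proof.
move=> H t t0; rewrite -lerN2 -mulNr.
apply: (gronwall (u := fun t => - q t)) => //.
  move=> s s0 e e0; have [d d0 dP] := @hform_traj_continuous S x xC s s0 e e0.
  exists d => // r r0 rs.
  have -> : - q r - - q s = - (q r - q s) by rewrite opprB opprK addrC.
  by rewrite normrN; exact: (dP r r0 rs).
move=> s s0 e e0; have [d d0 dP] := hform_right_derivative S (xD s0) e0.
exists d => // h h0 hd.
have -> : h * (2 * k * - q s + e) = - (h * (2 * (k * q s))) + e * h by ring.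
by apply: close_ge (dP h h0 hd) _; rewrite ler_pM2l// ler_pM2l//; exact: H.
Qed.

End Energy.

Section Semigroup.
Variables (D : set V) (phi : R -> V -> V) (f : V -> V).
Hypothesis hphi : continuous_semigroup D phi.

Lemma semigroup_right_continuous z t : D z -> 0 <= t -> forall e : R, 0 < e ->
  exists2 d : R, 0 < d & forall h, 0 < h -> h < d -> rnorm (phi (t + h) z - phi t z) < e.
Proof.
case: hphi => _ st law c0 Dz t0 e e0.
have [d d0 dP] := iffLR (cvg_at_right0_rnormP _ _) (c0 _ (st _ _ t0 Dz)) e e0.
by exists d => // h h0 hd; rewrite [t + h]addrC law// ?ltW//; exact: dP.
Qed.

Lemma semigroup0 z : D z -> phi 0 z = z.
Proof.
move=> Dz; apply/eqP; rewrite -subr_eq0; apply/eqP; apply: rnorm_eq0.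
apply/eqP; rewrite eq_le rnorm_ge0 andbT; apply: (@le0_of_eps _ _ 2) => e e0.
have [d d0 dP] := semigroup_right_continuous Dz (lexx 0) e0.
have [_ _ _ c0] := hphi.
have [d' d'0 d'P] := iffLR (cvg_at_right0_rnormP _ _) (c0 _ Dz) e e0.
pose h := Num.min d d' / 2.
have m0 : 0 < Num.min d d' by rewrite lt_min d0.
have [md md'] : Num.min d d' <= d /\ Num.min d d' <= d' by split; rewrite ge_min lexx ?orbT.
have h0 : 0 < h by rewrite divr_gt0.
have h1 : h < d by rewrite /h; lra.
have h2 : h < d' by rewrite /h; lra.
have := dP h h0 h1; have := d'P h h0 h2; rewrite add0r.
have -> : phi 0 z - z = (phi h z - z) - (phi h z - phi 0 z).
  by apply/matrixP => i j; rewrite !mxE; ring.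
by move=> k1 k2; apply: le_trans (rnormD _ _) _; rewrite rnormN; lra.
Qed.

(** Left-continuity at t: choose a continuity point tau < t of the trajectory and
    apply the continuous map phi (t - tau) to the convergence at tau. *)
Lemma semigroup_continuous z : D z -> traj_continuous (fun t => phi t z).
Proof.
case: (hphi) => dphi st law c0 Dz t t0 e e0.
have [d1 d10 d1P] := semigroup_right_continuous Dz t0 e0.
have [t_eq|t_ne] := eqVneq t 0.
  exists d1 => // s s0; rewrite t_eq subr0 => sd.
  have [->|sn] := eqVneq s 0; first by rewrite subrr rnorm0.
  have {}s0 : 0 < s by rewrite lt_neqAle eq_sym sn.
  by rewrite gtr0_norm// in sd; have := d1P s s0 sd; rewrite t_eq add0r.
have {t_ne} tp : 0 < t by rewrite lt_neqAle eq_sym t_ne.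
have [tau /andP[tau0 taut] tauC] := right_continuous_has_continuity_point
  (fun s s0 e e0 => semigroup_right_continuous Dz s0 e0) tp.
have Dtau : D (phi tau z) by apply: st => //; exact: ltW.
have tt0 : 0 <= t - tau by rewrite subr_ge0 ltW.
have [d2 d20 d2P] : exists2 d2 : R, 0 < d2 & forall w, rnorm (w - phi tau z) < d2 ->
    rnorm (phi (t - tau) w - phi (t - tau) (phi tau z)) < e.
  have /vderivable_lip[K K0 [d d0 dP]] := differentiable_vderivable (dphi _ tt0 _ Dtau).
  exists (Num.min d (e / K)); first by rewrite lt_min d0 divr_gt0.
  move=> w; rewrite lt_min ltr_pdivlMr// => /andP[/dP h1 h2].
  by apply: le_lt_trans h1 _; rewrite mulrC.
have [d3 d30 d3P] := tauC _ d20.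
exists (Num.min d1 (Num.min d3 tau)); first by rewrite !lt_min d10 d30.
move=> s s0; rewrite !lt_min => /andP[sd1 /andP[sd3 sdt]].
have [ts|st'] := ltP t s.
  have := d1P (s - t); rewrite subr_gt0 (_ : t + (s - t) = s); last by ring.
  apply=> //.
  by move: sd1; rewrite ger0_norm// subr_ge0 ltW.
have tauE : t = (t - tau) + tau by rewrite subrK.
have st1 : 0 <= tau + (s - t).
  by move: sdt; rewrite ltr_norml => /andP[h _]; lra.
have sE : s = (t - tau) + (tau + (s - t)) by ring.
have -> : phi s z = phi (t - tau) (phi (tau + (s - t)) z) by rewrite -law// -sE.
have -> : phi t z = phi (t - tau) (phi tau z) by rewrite -law ?(ltW tau0)// -tauE.
apply: d2P; apply: d3P.
by have -> : tau + (s - t) - tau = s - t by ring.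
Qed.

Lemma semigroup_right_derivative z t : generator D phi f -> D z -> 0 <= t ->
  right_derivative (fun t => phi t z) (f (phi t z)) t.
Proof.
case: (hphi) => _ st law _ [_ gen] Dz t0 e e0.
have [d d0 dP] := iffLR (cvg_at_right0_rnormP _ _) (gen _ (st _ _ t0 Dz)) e e0.
exists d => // h h0 hd; rewrite [t + h]addrC law ?(ltW h0)//.
have := dP h h0 hd.
set X := phi h _ - _; set w := f _.
have hC : h%:C != 0 :> R[i] by rewrite -[0]/(0%:C) (inj_eq (@complexI _)) gt_eqF.
have -> : X - h%:C *: w = h%:C *: ((h^-1)%:C *: X - w).
  by rewrite scalerBr scalerA fmorphV mulfV// scale1r.
rewrite [rnorm (h%:C *: _)]rnormZ rnormR gtr0_norm// => k.
by rewrite mulrC ler_pM2r// ltW.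
Qed.

End Semigroup.
End Trajectories.

(** * Dynamics near the common fixed point *)

Section LocalDynamics.
Context {R : realType} {n : nat}.
Notation V := 'cV[R[i]]_n.
Implicit Types (f : V -> V) (phi psi : R -> V -> V) (D : set V) (S A : 'M[R[i]]_n).

Lemma generator_difference S D phi psi f1 f2 z : D z ->
  generator D phi f1 -> generator D psi f2 ->
  forall e : R, 0 < e -> exists2 d : R, 0 < d & forall h, 0 < h -> h < d ->
    `|hform S (phi h z - psi h z) (phi h z - psi h z) / h ^+ 2 -
      hform S (f1 z - f2 z) (f1 z - f2 z)| < e.
Proof.
move=> Dz [_ g1] [_ g2] e e0.
have [d d0 dP] := hform_continuous S (f1 z - f2 z) e0.
have d2 : 0 < d / 2 by rewrite divr_gt0.
have [u u0 uP] := iffLR (cvg_at_right0_rnormP _ _) (g1 _ Dz) _ d2.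
have [v v0 vP] := iffLR (cvg_at_right0_rnormP _ _) (g2 _ Dz) _ d2.
exists (Num.min u v); first by rewrite lt_min u0.
move=> h h0; rewrite lt_min => /andP[/(uP _ h0) k1 /(vP _ h0) k2].
have := dP ((h^-1)%:C *: (phi h z - psi h z)).
rewrite hformZl hformZr mulrA -invfM -expr2 mulrC; apply.
have -> : (h^-1)%:C *: (phi h z - psi h z) - (f1 z - f2 z) =
  ((h^-1)%:C *: (phi h z - z) - f1 z) - ((h^-1)%:C *: (psi h z - z) - f2 z).
  by apply/matrixP => i j; rewrite !mxE; ring.
by apply: le_lt_trans (rnormD _ _) _; rewrite rnormN [d]splitr ltrD.
Qed.

Lemma dissipative_near0 S A f (a b eta : R) : S \in unitmx -> 0 < eta ->
  (forall x, - b * hform S x x <= hform S (A *m x) x <= - a * hform S x x) ->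
  (forall e : R, 0 < e -> exists2 d : R, 0 < d & forall x y, rnorm x < d -> rnorm y < d ->
    rnorm (f x - f y - A *m (x - y)) <= e * rnorm (x - y)) ->
  exists2 d : R, 0 < d & forall x y, rnorm x < d -> rnorm y < d ->
    - (b + eta) * hform S (x - y) (x - y) <= hform S (f x - f y) (x - y)
      <= - (a - eta) * hform S (x - y) (x - y).
Proof.
move=> Su eta0 SA fA.
have [C C0 CP] := hform_bound S; have [c c0 cP] := hform_coercive Su.
have e0 : 0 < eta / (C * c) by rewrite divr_gt0// mulr_gt0.
have [d d0 dP] := fA _ e0; exists d => // x y xd yd.
set w := x - y.
have /andP[h1 h2] := SA w.
have k : `|hform S (f x - f y - A *m w) w| <= eta * hform S w w.
  apply: le_trans (CP _ _) _.
  apply: (@le_trans _ _ (C * (eta / (C * c) * rnorm w * rnorm w))).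
    by rewrite ler_pM2l// ler_wpM2r ?rnorm_ge0//; exact: dP.
  have -> : C * (eta / (C * c) * rnorm w * rnorm w) = eta / c * rnorm w ^+ 2.
    by field; rewrite !gt_eqF.
  by rewrite mulrAC ler_pdivrMr// -mulrA ler_pM2l// mulrC; exact: cP.
rewrite (hformBl S (f x - f y) (A *m w) w) ler_norml in k; case/andP: k => k1 k2.
set X := hform S w w in h1 h2 k1 k2 *; set Y := hform S (A *m w) w in h1 h2 k1 k2.
set Z := hform S (f x - f y) w in k1 k2 *.
by apply/andP; split; clear -h1 h2 k1 k2; lra.
Qed.

(** The sublevel set hform S z z < r plays the role of a ball around 0: f points
    inwards there, which keeps orbits inside and makes the rates a and b valid for
    all times. *)
Section Trapped.
Variables (D : set V) (phi : R -> V -> V) (f : V -> V) (S : 'M[R[i]]_n) (a b r : R).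
Hypotheses (hphi : continuous_semigroup D phi) (hf : generator D phi f).
Hypothesis rD : forall z, hform S z z < r -> D z.
Hypothesis a0 : 0 <= a.
Hypothesis f_up : forall z, hform S z z < r -> hform S (f z) z <= - a * hform S z z.
Hypothesis f_low : forall x y, hform S x x < r -> hform S y y < r ->
  - b * hform S (x - y) (x - y) <= hform S (f x - f y) (x - y).

Lemma trapped z t : hform S z z < r -> 0 <= t -> hform S (phi t z) (phi t z) < r.
Proof.
move=> zr t0; have Dz := rD zr; have z0 := semigroup0 hphi Dz.
have := @energy_trapped _ _ S (fun t => phi t z) (fun t => f (phi t z)) (semigroup_continuous hphi Dz)
  (fun s s0 => semigroup_right_derivative hphi hf Dz s0) r.
rewrite /= z0 => /(_ zr) H; apply: le_lt_trans zr; apply: H => // s s0 sr.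
by apply: le_trans (f_up sr) _; rewrite mulNr oppr_le0 mulr_ge0// hform_ge0.
Qed.

Lemma trapped_decay z t : hform S z z < r -> 0 <= t ->
  hform S (phi t z) (phi t z) <= hform S z z * expR (2 * - a * t).
Proof.
move=> zr t0; have Dz := rD zr; have z0 := semigroup0 hphi Dz.
have := @energy_upper _ _ S (fun t => phi t z) (fun t => f (phi t z)) (semigroup_continuous hphi Dz)
  (fun s s0 => semigroup_right_derivative hphi hf Dz s0) (- a).
by rewrite /= z0; apply=> // s s0; apply: f_up; exact: trapped.
Qed.

Lemma trapped_spread x y t : hform S x x < r -> hform S y y < r -> 0 <= t ->
  hform S (x - y) (x - y) * expR (2 * - b * t) <=
  hform S (phi t x - phi t y) (phi t x - phi t y).
Proof.
move=> xr yr t0; have Dx := rD xr; have Dy := rD yr.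
have := @energy_lower _ _ S (fun t => phi t x - phi t y) (fun t => f (phi t x) - f (phi t y))
  (traj_continuousB (semigroup_continuous hphi Dx) (semigroup_continuous hphi Dy))
  (fun s s0 => right_derivativeB (semigroup_right_derivative hphi hf Dx s0)
    (semigroup_right_derivative hphi hf Dy s0)) (- b).
rewrite /= (semigroup0 hphi Dx) (semigroup0 hphi Dy); apply=> // s s0.
by apply: f_low; exact: trapped.
Qed.

End Trapped.

End LocalDynamics.

(** * Agreement near the fixed point *)

Lemma scaled_le_of_close (R : realType) (X Y P Q E e : R) : 0 < E -> `|Q - Y| < e -> `|P - X| < e ->
  P * E <= Q -> X * E - Y <= e * (E + 1).
Proof.
rewrite !ltr_norml => E0 /andP[_ QY] /andP[PX _] PQ.
have : X * E <= (P + e) * E by rewrite ler_pM2r//; lra.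
by rewrite mulrDl mulrDr; lra.
Qed.

(** The rates a and b are those of the vector fields on a sublevel set of hform: the
    rates of the linear part, weakened by the nonlinear terms. *)
Section Uniqueness.
Context {R : realType} {n : nat}.
Notation V := 'cV[R[i]]_n.
Variables (D : set V) (phi psi : R -> V -> V) (f1 f2 : V -> V) (S : 'M[R[i]]_n) (a b r : R).
Hypotheses (hphi : continuous_semigroup D phi) (hpsi : continuous_semigroup D psi).
Hypotheses (hf1 : generator D phi f1) (hf2 : generator D psi f2).
Hypothesis hcomm : semigroups_commute D phi psi.
Hypothesis Su : S \in unitmx.
Hypothesis rD : forall z, hform S z z < r -> D z.
Hypotheses (a0 : 0 < a) (ba : b < 2 * a).
Hypothesis f1_up : forall z, hform S z z < r -> hform S (f1 z) z <= - a * hform S z z.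
Hypothesis f2_up : forall z, hform S z z < r -> hform S (f2 z) z <= - a * hform S z z.
Hypothesis f1_pair : forall x y, hform S x x < r -> hform S y y < r ->
  - b * hform S (x - y) (x - y) <= hform S (f1 x - f1 y) (x - y) <= 0.
Variable C : R.
Hypothesis C0 : 0 <= C.
Hypothesis gC : forall z, hform S z z < r ->
  hform S (f2 z - f1 z) (f2 z - f1 z) <= C * hform S z z ^+ 2.

(** By commutation, psi h (phi t z) - phi h (phi t z) is the difference of the images
    under phi t of psi h z and phi h z, so trapped_spread bounds it from below;
    divide by h^2 and let h tend to 0. *)
Lemma generator_gap_transport z t : hform S z z < r -> 0 <= t ->
  hform S (f2 z - f1 z) (f2 z - f1 z) * expR (2 * - b * t) <=
  hform S (f2 (phi t z) - f1 (phi t z)) (f2 (phi t z) - f1 (phi t z)).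
Proof.
move=> zr t0; have Dz := rD zr.
have zt := trapped hphi hf1 rD (ltW a0) f1_up zr t0; have Dzt := rD zt.
have f1_low x y : hform S x x < r -> hform S y y < r ->
  - b * hform S (x - y) (x - y) <= hform S (f1 x - f1 y) (x - y).
  by move=> xr yr; have /andP[] := f1_pair xr yr.
set E := expR _; have E0 : 0 < E by exact: expR_gt0.
rewrite -subr_le0; apply: (@le0_of_eps _ _ (E + 1)) => e e0.
have [d d0 dP] := generator_difference S Dz hf2 hf1 e0.
have [d' d'0 d'P] := generator_difference S Dzt hf2 hf1 e0.
pose h := Num.min d d' / 2.
have m0 : 0 < Num.min d d' by rewrite lt_min d0.
have [md md'] : Num.min d d' <= d /\ Num.min d d' <= d' by split; rewrite ge_min lexx ?orbT.
have h0 : 0 < h by rewrite divr_gt0.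
have hd : h < d by rewrite /h; lra.
have hd' : h < d' by rewrite /h; lra.
have k1 := d'P h h0 hd'; have k2 := dP h h0 hd.
have psir := trapped hpsi hf2 rD (ltW a0) f2_up zr (ltW h0).
have phir := trapped hphi hf1 rD (ltW a0) f1_up zr (ltW h0).
have := trapped_spread hphi hf1 rD (ltW a0) f1_up f1_low psir phir t0.
have [_ _ law _] := hphi.
rewrite (hcomm t0 (ltW h0) Dz) -(law t h z t0 (ltW h0) Dz) [t + h]addrC
  (law h t z (ltW h0) t0 Dz) -/E.
have hh : 0 < (h ^+ 2)^-1 by rewrite invr_gt0 exprn_gt0.
rewrite -(ler_pM2r hh).
by rewrite mulrAC; apply: (scaled_le_of_close _ k1 k2).
Qed.

(** The gap at z is at most a multiple of exp(-(4 a - 2 b) t) for all t, the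
    exponents being doubled because hform is the square of a norm. *)
Lemma generators_agree z : hform S z z < r -> f1 z = f2 z.
Proof.
move=> zr; have [c c0 cP] := hform_coercive Su.
apply/eqP; rewrite eq_sym -subr_eq0; apply/eqP.
suff X0 : hform S (f2 z - f1 z) (f2 z - f1 z) <= 0.
  apply: rnorm_eq0; apply/eqP; rewrite -sqrf_eq0 eq_le sqr_ge0 andbT.
  by apply: le_trans (cP _) _; rewrite pmulr_rle0.
apply: (@exp_rate_le0 _ _ (C * hform S z z ^+ 2) (4 * a - 2 * b)); first by move: ba; lra.
move=> t t0; have /= h1 := generator_gap_transport zr t0.
have h2 := trapped_decay hphi hf1 rD (ltW a0) f1_up zr t0.
have h3 := gC (trapped hphi hf1 rD (ltW a0) f1_up zr t0).
have h4 : hform S (phi t z) (phi t z) ^+ 2 <= hform S z z ^+ 2 * expR (- 4 * a * t).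
  have -> : hform S z z ^+ 2 * expR (- 4 * a * t) = (hform S z z * expR (2 * - a * t)) ^+ 2.
    by rewrite exprMn -expRM_natl; congr (_ * expR _); ring.
  by rewrite lerXn2r ?nnegrE ?hform_ge0// mulr_ge0 ?hform_ge0// ltW// expR_gt0.
have -> : - (4 * a - 2 * b) * t = - 4 * a * t - 2 * - b * t by ring.
rewrite expRB mulrA ler_pdivlMr ?expR_gt0//.
apply: le_trans h1 (le_trans h3 _).
by rewrite -mulrA ler_wpM2l.
Qed.

Lemma semigroups_agree z t : hform S z z < r -> 0 <= t -> phi t z = psi t z.
Proof.
move=> zr t0; have Dz := rD zr; have [c c0 cP] := hform_coercive Su.
have := @energy_upper _ _ S (fun t => phi t z - psi t z) (fun t => f1 (phi t z) - f2 (psi t z))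
  (traj_continuousB (semigroup_continuous hphi Dz) (semigroup_continuous hpsi Dz))
  (fun s s0 => right_derivativeB (semigroup_right_derivative hphi hf1 Dz s0)
    (semigroup_right_derivative hpsi hf2 Dz s0)) 0.
rewrite /= (semigroup0 hphi Dz) (semigroup0 hpsi Dz) subrr hform0 => /(_ _ t t0) H.
apply/eqP; rewrite -subr_eq0; apply/eqP.
apply: rnorm_eq0; apply/eqP; rewrite -sqrf_eq0 eq_le sqr_ge0 andbT.
apply: le_trans (cP _) _; rewrite pmulr_rle0//.
rewrite mul0r in H; apply: H => s s0; rewrite mul0r.
have sphi := trapped hphi hf1 rD (ltW a0) f1_up zr s0.
have spsi := trapped hpsi hf2 rD (ltW a0) f2_up zr s0.
by rewrite -(generators_agree spsi); have /andP[] := f1_pair sphi spsi.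
Qed.

End Uniqueness.

Unset Implicit Arguments.

Theorem corollary3 (R : realType) (n : nat) (hn : (0 < n)%N)
    (D : set 'cV[R[i]]_n)
    (phi psi : R -> 'cV[R[i]]_n -> 'cV[R[i]]_n)
    (f1 f2 : 'cV[R[i]]_n -> 'cV[R[i]]_n) (A : 'M[R[i]]_n)
    (hD : complex_domain D) (hO : D 0)
    (hphi : continuous_semigroup D phi) (hpsi : continuous_semigroup D psi)
    (hf1 : generator D phi f1) (hf2 : generator D psi f2)
    (hf1O : f1 0 = 0) (hf2O : f2 0 = 0)
    (hcomm : semigroups_commute D phi psi)
    (hA1 : 'd f1 (0 : 'cV[R[i]]_n) = mulmx A :> ('cV[R[i]]_n -> 'cV[R[i]]_n))
    (hA2 : 'd f2 (0 : 'cV[R[i]]_n) = mulmx A :> ('cV[R[i]]_n -> 'cV[R[i]]_n))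
    (hspec : forall a : R[i], spectrum A a -> complex.Re a < 0)
    (hlambda : spectrum_distortion A < 2) :
  forall t z, 0 <= t -> D z -> phi t z = psi t z.
Proof.
have [oD cD _] := hD.
have [S [a [b [Su a0 ba SA]]]] := lyapunov_form hn hspec hlambda.
have [r0 r00 r0D] := iffLR (nbhs_rnormP 0 D) (open_nbhs_nbhs (conj oD hO)).
have r0D' z : rnorm z < r0 -> D z by move=> zr; apply: r0D; rewrite subr0.
have [hol1 _] := hf1; have [hol2 _] := hf2.
have V1 z : D z -> vderivable f1 z by move/hol1; exact: differentiable_vderivable.
have V2 z : D z -> vderivable f2 z by move/hol2; exact: differentiable_vderivable.
have A1 e : 0 < e -> exists2 d : R, 0 < d & forall z, rnorm z < d ->
    rnorm (f1 z - A *m z) <= e * rnorm z.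
  move=> /(differentiable_rnorm (hol1 _ hO))[d d0 dP]; exists d => // z.
  by have := dP z; rewrite hA1 hf1O !subr0.
have A2 e : 0 < e -> exists2 d : R, 0 < d & forall z, rnorm z < d ->
    rnorm (f2 z - A *m z) <= e * rnorm z.
  move=> /(differentiable_rnorm (hol2 _ hO))[d d0 dP]; exists d => // z.
  by have := dP z; rewrite hA2 hf2O !subr0.
have gO e : 0 < e -> exists2 d : R, 0 < d & forall z, rnorm z < d ->
    rnorm (f2 z - f1 z) <= e * rnorm z.
  move=> e0; have e2 : 0 < e / 2 by rewrite divr_gt0.
  have [d d0 dP] := A1 _ e2; have [d' d'0 d'P] := A2 _ e2.
  exists (Num.min d d'); first by rewrite lt_min d0.
  move=> z; rewrite lt_min => /andP[/dP h1 /d'P h2].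
  have -> : f2 z - f1 z = (f2 z - A *m z) - (f1 z - A *m z) by rewrite opprB addrA subrK.
  by apply: le_trans (rnormD _ _) _; rewrite rnormN [e]splitr mulrDl lerD.
(* The nonlinear remainder may cost eta in each rate: 3 eta < 2 a - b keeps the gap
   open and eta <= a / 2 keeps the decay rate positive. *)
pose eta := Num.min ((2 * a - b) / 4) (a / 2).
have eta0 : 0 < eta by rewrite lt_min !divr_gt0// subr_gt0.
have [eta1 eta2] : eta <= (2 * a - b) / 4 /\ eta <= a / 2 by split; rewrite ge_min lexx ?orbT.
have [d1 d10 P1] := dissipative_near0 Su eta0 SA
  (strict_derivative r00 hf1O (fun z zr => V1 z (r0D' z zr)) A1).
have [d2 d20 P2] := dissipative_near0 Su eta0 SA
  (strict_derivative r00 hf2O (fun z zr => V2 z (r0D' z zr)) A2).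
have [K K0 [d3 d30 P3]] := quadratic_bound r00
  (fun z zr => vderivableB (V2 z (r0D' z zr)) (V1 z (r0D' z zr))) gO.
have [c c0 cP] := hform_coercive Su; have [B B0 BP] := hform_bound S.
pose rho := Num.min (Num.min r0 d1) (Num.min d2 d3).
have rho0 : 0 < rho by rewrite !lt_min r00 d10 d20.
have [rho_r0 rho1 rho2 rho3] : [/\ rho <= r0, rho <= d1, rho <= d2 & rho <= d3].
  by split; rewrite /rho !ge_min lexx ?orbT.
pose r := rho ^+ 2 / c.
have rr z : hform S z z < r -> rnorm z < rho.
  rewrite ltr_pdivlMr// mulrC => zr.
  by rewrite -(@ltr_pXn2r _ 2) ?nnegrE ?rnorm_ge0 ?(ltW rho0)//; exact: le_lt_trans (cP z) zr.
have rD z : hform S z z < r -> D z by move=> /rr zr; apply: r0D'; exact: lt_le_trans rho_r0.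
have z0 d : 0 < d -> rnorm (0 : 'cV[R[i]]_n) < d by rewrite rnorm0.
have agree z t : hform S z z < r -> 0 <= t -> phi t z = psi t z.
  apply: (@semigroups_agree _ _ D phi psi f1 f2 S (a - eta) (b + eta) r _ _ _ _ _ _ _ _ _ _ _ _
    (B * K ^+ 2 * c ^+ 2)) => //.
  - by lra.
  - by lra.
  - move=> y /rr yr; have /andP[_] := P1 y 0 (lt_le_trans yr rho1) (z0 _ d10).
    by rewrite hf1O !subr0.
  - move=> y /rr yr; have /andP[_] := P2 y 0 (lt_le_trans yr rho2) (z0 _ d20).
    by rewrite hf2O !subr0.
  - move=> x y /rr xr /rr yr.
    have /andP[h1 h2] := P1 x y (lt_le_trans xr rho1) (lt_le_trans yr rho1).
    rewrite h1 /=; apply: le_trans h2 _; rewrite mulNr oppr_le0 mulr_ge0 ?hform_ge0//.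
    by lra.
  - by rewrite mulr_ge0 ?sqr_ge0// mulr_ge0 ?sqr_ge0// ltW.
  - move=> y yr; have /rr yr' := yr.
    have h1 := P3 y (lt_le_trans yr' rho3).
    apply: le_trans (ler_norm _) _; apply: le_trans (BP _ _) _.
    have h2 : rnorm (f2 y - f1 y) <= K * (c * hform S y y).
      by apply: le_trans h1 _; rewrite ler_pM2l//; exact: cP.
    have -> : B * K ^+ 2 * c ^+ 2 * hform S y y ^+ 2 =
      B * (K * (c * hform S y y) * (K * (c * hform S y y))) by ring.
    by rewrite ler_pM2l// ler_pM// rnorm_ge0.
move=> t z t0 Dz; apply/eqP; rewrite -subr_eq0; apply/eqP.
have [hol_phi _ _ _] := hphi; have [hol_psi _ _ _] := hpsi.
apply: (@identity_theorem R n D (fun z => phi t z - psi t z)) => //.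
- move=> y Dy; apply: vderivableB; apply: differentiable_vderivable.
    exact: hol_phi.
  exact: hol_psi.
- have r_gt0 : 0 < r by rewrite divr_gt0// exprn_gt0.
  have [d d0 dP] := hform_continuous S 0 r_gt0; exists d => // y yd.
  rewrite agree ?subrr//; have := dP y; rewrite subr0 hform0 subr0 => /(_ yd).
  exact: le_lt_trans (ler_norm _).
Qed.
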